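(* The bottom row of each homogeneous variational bicomplex is locally exact, modulo pullbacks. That is, let $k>-m$ be an integer and $N_{m-1}=\dim\mathcal F^{k+m-1}$. The row \[ 0\to\overline\Xi^0_{k+m}\xrightarrow{\delta}\Xi^1_{k+m}\xrightarrow{\delta}\Xi^2_{k+m}\xrightarrow{\delta}\cdots\xrightarrow{\delta}\Xi^{N_{m-1}}_{k+m}\xrightarrow{\delta}\Omega^{N_{m-1}+1,m}_{k+m} \] is, as a sequence of sheaves of germs, exact modulo pullbacks at $\overline\Xi^0_{k+m}$ and at every $\Xi^r_{k+m}$, $1\le r\le N_{m-1}$: given a germ of a class $\xi$ in the kernel of the outgoing map $\delta$, represented by $\Phi\in\Omega^{r,m}_{k+m}(U)$ with $U\subset\mathcal F^{k+m}$ open (where $r=0$ for $\xi\in\overline\Xi^0_{k+m}$), there is $l>k+m$ such that, near every point $b\in\mathcal F^l$ lying over $U$ (after shrinking $U$ so that $\delta\xi=0$ on $U$), the class of $(\tau^{l,k+m})^*\Phi$ in $\Xi^r_l$ is equal to $\delta\eta$ for some germ $\eta$ of $\Xi^{r-1}_l$ (of $\overline\Xi^0_l$ if $r=1$), when $r\ge1$; and the class of $(\tau^{l,k+m})^*\Phi$ in $\overline\Xi^0_l$ vanishes, when $r=0$.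
   Context: $E$ is a smooth manifold with local coordinates $(u^\alpha)$, $m\ge1$. For $k\ge0$, $\mathcal F^k=\mathcal F^k_{(m)}E$ is the manifold of $k$-jets $j^k_0\gamma$ at $0\in\mathbf R^m$ of immersions $\gamma$ from a neighbourhood of $0$ in $\mathbf R^m$ to $E$, with local coordinates $u^\alpha_I(j^k_0\gamma)=\partial^{|I|}(u^\alpha\circ\gamma)/\partial t^I(0)$ for multi-indices $I\in\mathbf N^m$, $0\le|I|\le k$; $\tau^{l,k}:\mathcal F^l\to\mathcal F^k$ ($l\ge k$) is the projection. $1_i$ is the multi-index with $1$ in position $i$ and $0$ elsewhere. For $U\subset\mathcal F^k$ open, $\Omega^{r,s}_k(U)=\Omega^r(U)\otimes\bigwedge^s\mathbf R^{m*}$ is the space of $r$-forms on $U$ with values in $\bigwedge^s\mathbf R^{m*}$; $dt^1,\dots,dt^m$ is the standard basis of $\mathbf R^{m*}$. The exterior derivative acts by $d(\theta\otimes w)=d\theta\otimes w$. The total derivative $d_i:\Omega^r(U)\to\Omega^r((\tau^{k+1,k})^{-1}(U))$ is the degree-zero derivation along the pullback map, commuting with $d$, given on functions by $d_if=\sum_{|I|=0}^ku^\alpha_{I+1_i}\,\partial f/\partial u^\alpha_I$. The total exterior derivative is $d_{\mathrm T}:\Omega^{r,s}_k(U)\to\Omega^{r,s+1}_{k+1}((\tau^{k+1,k})^{-1}(U))$, $d_{\mathrm T}(\theta\otimes w)=d_i\theta\otimes(dt^i\wedge w)$ (summed over $i$); $d$ and $d_{\mathrm T}$ commute. $\overline\Omega^{0,s}=\Omega^{0,s}/\bigwedge^s\mathbf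 R^{m*}$ is the quotient by the constant vector-valued functions. For $l\ge1$, $\Xi^r_l=\Omega^{r,m}_l/d_{\mathrm T}\Omega^{r,m-1}_{l-1}$ for $r\ge1$, and $\overline\Xi^0_l=\overline\Omega^{0,m}_l/d_{\mathrm T}\overline\Omega^{0,m-1}_{l-1}$, all read as (sheaves of) germs: a form germ at $b\in\mathcal F^l$ is zero in the quotient iff it is $d_{\mathrm T}$ of a germ at $\tau^{l,l-1}(b)$ (plus a constant if $r=0$). The map $\delta$ is induced by $d$ on these quotients; note $\Xi^{r}_{k+m}=\Omega^{r,m}_{k+m}$ when $r>N_{m-1}$. The homogeneous variational bicomplex of index $k>-m$ has as columns (indexed by the form degree $r\ge0$) the complexes of the $\Omega^{r,s}_{k+s}$ (of the $\overline\Omega^{0,s}_{k+s}$ if $r=0$) under $d_{\mathrm T}$, for those $s\in\{0,\dots,m\}$ with $k+s\ge0$, followed by the quotient $\Xi^r_{k+m}$ (resp. $\overline\Xi^0_{k+m}$); its bottom row consists of these quotients with the maps $\delta$. *)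

(* Defs.v *)
From HB Require Import structures.
From mathcomp Require Import all_boot all_order all_algebra.
From mathcomp Require Import all_classical all_reals all_analysis.
Set Implicit Arguments.
Unset Strict Implicit.
Unset Printing Implicit Defensive.
Import Order.TTheory GRing.Theory Num.Theory numFieldNormedType.Exports.
Local Open Scope classical_set_scope.
Local Open Scope ring_scope.

Section Smooth.
Variables (R : realType) (V W : normedModType R).

Definition iter_derive (f : V -> W) (s : seq V) : V -> W :=
  foldr (fun v g p => 'D_v g p) f s.

(* Class C^oo, in the finite-dimensional case (the only one used): all iterated
   directional derivatives are differentiable at the points of O. *)
Definition smooth_on (O : set V) (f : V -> W) : Prop :=
  forall (s : seq V) (p : V), O p -> differentiable (iter_derive f s) p.

End Smooth.

Section Manifold.
Variables (R : realType) (n : nat).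

Record chart (T : topologicalType) := Chart {
  cdom : set T;
  cmap : T -> 'rV[R]_n;
  cinv : 'rV[R]_n -> T;
  cdom_open : open cdom;
  cimg_open : open (cmap @` cdom);
  cmapK : forall p, cdom p -> cinv (cmap p) = p;
  cmap_continuous : forall p, cdom p -> {for p, continuous cmap};
  cinv_continuous : forall c, (cmap @` cdom) c -> {for c, continuous cinv} }.

Record manifold := Manifold {
  carrier :> topologicalType;
  manifold_hausdorff : hausdorff_space carrier;
  manifold_second_countable : @second_countable carrier;
  atlas : set (chart carrier);
  atlas_cover : forall p, exists2 x, atlas x & cdom x p;
  atlas_smooth : forall x y, atlas x -> atlas y ->
    smooth_on (cmap x @` (cdom x `&` cdom y)) (cmap y \o cinv x) }.

End Manifold.

Section MultiIndex.
Variables (m k : nat).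

(* The multi-indices I in N^m with |I| <= k, and their listing by 'I_nmi. *)
Definition mindex := {I : {ffun 'I_m -> 'I_k.+1} | (\sum_i I i <= k)%N}.
Definition nmi : nat := #|{: mindex}|.
Definition mi (j : 'I_nmi) : {ffun 'I_m -> nat} :=
  [ffun i => nat_of_ord (val (enum_val j) i)].

End MultiIndex.

(* I + 1_i *)
Definition mi_add1 (m : nat) (I : {ffun 'I_m -> nat}) (i : 'I_m) :
  {ffun 'I_m -> nat} := [ffun i' => (I i' + (i' == i))%N].

(* The dimension of the manifold of k-jets. *)
Definition jet_dim (m n k : nat) : nat := (n * nmi m k)%N.

Section Jets.
Variables (R : realType) (m n : nat) (E : manifold R n).

(* A germ at 0 is represented by any total function inducing it. *)
Definition immersion0 (g : 'rV[R]_m -> E) : Prop :=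
  \forall t \near (0 : 'rV[R]_m), exists2 x, atlas x &
    (exists O : set 'rV[R]_m,
      [/\ open O, O t, g @` O `<=` cdom x & smooth_on O (cmap x \o g)])
    /\ injective ('d (cmap x \o g) t).

Definition mi_deriv (I : {ffun 'I_m -> nat}) (f : 'rV[R]_m -> R) :
  'rV[R]_m -> R :=
  foldr (fun i => iter (I i) (fun h t => 'D_(delta_mx 0 i) h t)) f (enum 'I_m).

(* The entry (alpha, j) of a point of this space is the coordinate
   u^alpha_I, I = mi j. *)
Definition jspace (k : nat) := 'M[R]_(n, nmi m k).

(* The coordinates (u^alpha_I) of the k-jet of g at 0. *)
Definition jcoord (x : chart R n E) (k : nat) (g : 'rV[R]_m -> E) : jspace k :=
  \matrix_(a, j) mi_deriv (mi j) (fun t => cmap x (g t) 0 a) 0.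

Definition same_jet (k : nat) (g h : 'rV[R]_m -> E) : Prop :=
  g 0 = h 0 /\
  forall x, atlas x -> cdom x (g 0) -> jcoord x k g = jcoord x k h.

Definition jet (k : nat) (g : 'rV[R]_m -> E) : set ('rV[R]_m -> E) :=
  [set h | immersion0 h /\ same_jet k g h].

Definition jets (k : nat) : set (set ('rV[R]_m -> E)) := jet k @` immersion0.

Definition jets_in_chart (x : chart R n E) (k : nat) :
  set (set ('rV[R]_m -> E)) :=
  jet k @` [set g | immersion0 g /\ cdom x (g 0)].

(* The image under the coordinates (u^alpha_I) given by x of the part of U lying over the
   domain of x. *)
Definition jimage (x : chart R n E) (k : nat) (U : set (set ('rV[R]_m -> E))) :
  set (jspace k) :=
  [set jcoord x k g | g in
    [set g | [/\ immersion0 g, cdom x (g 0) & U (jet k g)]]].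

Arguments jimage x k U : clear implicits.

Definition jet_open (k : nat) (U : set (set ('rV[R]_m -> E))) : Prop :=
  U `<=` jets k /\ forall x, atlas x -> open (jimage x k U).

End Jets.
Arguments jimage {R m n E} x k U.

Section Forms.
Variables (R : realType) (m n : nat).
Local Notation J := (jspace R m n).

(* u^alpha_I as a linear function on J k, extended by 0 to |I| > k. *)
Definition ucoord (k : nat) (p : J k) (a : 'I_n) (I : {ffun 'I_m -> nat}) : R :=
  \sum_(j | mi j == I) p a j.

(* tau^{l,k} in coordinates, for k <= l.  It is linear, and thus also its own
   tangent map. *)
Definition jproj (l k : nat) (p : J l) : J k :=
  \matrix_(a, j) ucoord p a (mi j).

(* The linear map with u^alpha_I (jshift i p) = u^alpha_{I+1_i} (p), for
   k < l. *)
Definition jshift (l k : nat) (i : 'I_m) (p : J l) : J k :=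
  \matrix_(a, j) ucoord p a (mi_add1 (mi j) i).

(* An r-form, as a function of a point and of r tangent vectors. *)
Definition form (r k : nat) := J k -> ('I_r -> J k) -> R.

(* A form with values in the exterior algebra of R^m*, given by its components
   on the basis dt^S := dt^{i_1} /\ ... /\ dt^{i_s}, where
   S = {i_1 < ... < i_s}. *)
Definition vform (r k : nat) := {set 'I_m} -> form r k.

Definition is_form (r k : nat) (O : set (J k)) (w : form r k) : Prop :=
  [/\ forall v, smooth_on O (fun p => w p v),
      forall p v j c (a b : J k), O p ->
        w p [eta v with j |-> c *: a + b]
        = c * w p [eta v with j |-> a] + w p [eta v with j |-> b]
    & forall p v i j, O p -> i != j -> v i = v j -> w p v = 0].

(* Omega^{r,s}_k(O) *)
Definition Omega (r s k : nat) (O : set (J k)) (w : vform r k) : Prop :=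
  (forall S, is_form O (w S)) /\
  (forall (S : {set 'I_m}) p v, O p -> #|S| != s -> w S p v = 0).

Definition pull (r k l : nat) (w : vform r k) : vform r l :=
  fun S p v => w S (jproj k p) (fun j => jproj k (v j)).

Definition extd (r k : nat) (w : form r k) : form r.+1 k :=
  fun p v => \sum_(i < r.+1)
    ((-1) ^+ i : R) * 'D_(v i) (fun q => w q (fun j => v (lift i j))) p.

Definition vextd (r k : nat) (w : vform r k) : vform r.+1 k :=
  fun S => extd (w S).

(* The total derivative d_i, used with l = k + 1. *)
Definition dtot_fun (k l : nat) (i : 'I_m) (f : J k -> R) (p : J l) : R :=
  \sum_(a < n) \sum_(j < nmi m k)
    ucoord p a (mi_add1 (mi j) i) * 'D_(delta_mx a j) f (jproj k p).

(* As d_i is a derivation and commutes with d, it differentiates the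
   coefficients and replaces in turn each du^alpha_I by
   d (d_i u^alpha_I) = du^alpha_{I+1_i}, that is by du^alpha_I \o jshift i. *)
Definition dtot (r k l : nat) (i : 'I_m) (w : form r k) : form r l :=
  fun p v =>
    let tv := fun j => jproj k (v j) in
    dtot_fun i (fun q => w q tv) p
    + \sum_(j < r) w (jproj k p) [eta tv with j |-> jshift k i (v j)].

(* d_T, used with l = k + 1: for i in S, dt^i /\ dt^{S \ i} = +/- dt^S, the
   sign being given by the number of elements of S before i. *)
Definition dT (r k l : nat) (w : vform r k) : vform r l :=
  fun S p v => \sum_(i in S)
    (-1) ^+ #|[set j in S | (j < i)%N]| * dtot i (w (S :\ i)%SET) p v.

(* The elements of Omega^{r,s}_k(U), U open in the manifold of k-jets: they
   are given by their expressions in the charts of the atlas.  The map T is the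
   change of the coordinates u^alpha_I; only its values on the open set
   jimage x k (U `&` jets_in_chart y k) matter, and these are prescribed. *)
Definition Omega_on (E : manifold R n) (r s k : nat)
    (U : set (set ('rV[R]_m -> E))) (w : chart R n E -> vform r k) : Prop :=
  (forall x, atlas x -> Omega s (jimage x k U) (w x)) /\
  forall (x y : chart R n E) (T : J k -> J k), atlas x -> atlas y ->
    (forall g : 'rV[R]_m -> E, immersion0 g ->
       cdom x (g 0) -> cdom y (g 0) -> U (jet k g) ->
       T (jcoord x k g) = jcoord y k g) ->
    forall S p v, jimage x k (U `&` jets_in_chart y k) p ->
      w x S p v = w y S (T p) (fun j => 'D_(v j) T p).

(* A germ of a form is given by its expression in any one chart around the
   point.  For l >= 1, the germ w at p is zero in Xi^r_l (in the reduced
   quotient if r = 0): it is d_T of a germ z of degree (r, m - 1) at the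
   projection of p, plus a constant c if r = 0. *)
Definition Xi_zero (r l : nat) (p : J l) (w : vform r l) : Prop :=
  exists (W : set (J l.-1)) (z : vform r l.-1) (c : {set 'I_m} -> R),
  [/\ open W, W (jproj l.-1 p) & Omega m.-1 W z] /\
  [/\ forall S : {set 'I_m}, #|S| != m -> c S = 0,
      (0 < r)%N -> forall S, c S = 0
    & \forall q \near p, forall S v, w S q v = dT z S q v + c S].

(* For l >= 1, the class of the germ of w at p is delta of a class of degree
   r - 1, or is zero if r = 0. *)
Definition Xi_exact (r l : nat) (p : J l) : vform r l -> Prop :=
  match r with
  | 0 => fun w => Xi_zero p w
  | r'.+1 => fun w => exists (W : set (J l)) (h : vform r' l),
      [/\ open W, W p, Omega m W h
        & Xi_zero p (fun S q v => w S q v - vextd h S q v)]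
  end.

End Forms.

(* Main.v *)
Require Import Defs.
From HB Require Import structures.
From mathcomp Require Import all_boot all_order all_algebra.
From mathcomp Require Import all_classical all_reals all_analysis.
From mathcomp Require Import ring lra zify.
Set Implicit Arguments.
Unset Strict Implicit.
Unset Printing Implicit Defensive.
Import Order.TTheory GRing.Theory Num.Theory numFieldNormedType.Exports.
Local Open Scope classical_set_scope.
Local Open Scope ring_scope.

(** The statement is local, and in one chart it only concerns the jet
    coordinates.  There it results from a diagram chase (closed_mod_dTb) in the
    variational bicomplex, in positive form degree: on a ball its rows are exact
    under d, by the Poincare lemma (poincare), and its columns are exact under
    d_T below the top degree (dTb_exact).

    Exactness of the columns comes from a Weyl algebra.  The total derivative
    d_i is the Lie derivative along the linear vector field that shifts the jet
    coordinates by 1_i; the d_i commute with each other and with d (lie_comm,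
    extd_lie).  Let S^i be the derivation of degree 0 that sends du_I to
    I(i) du_(I - 1_i) and vanishes on functions.  On r-forms
    [S^i, d_j] = r delta_ij (verb_totb), and S^i is nilpotent on forms of bounded
    order (verb_nilpotent).  For r > 0 the r-forms therefore behave like
    polynomials in the d_i, with S^i / r as i-th partial derivative, and d_T is
    the Koszul complex of the multiplications by the variables.  A cocycle is
    contracted one variable at a time, by division with remainder (koszul_exact).
    The division involves powers of d_i, so that the solution lives on jets of
    higher order: hence the pullbacks.

    The increase of the order is bounded in advance in terms of m, r and the
    initial order.  So a large order L is fixed and everything happens on a ball
    of the jets of order L, with total derivatives truncated in the top order:
    pullbacks become inclusions, and it suffices to keep track of the order of
    the jets on which a form depends (jorder). *)

(** * Smooth functions *)

Section Differentiability.
Variables (R : realType) (V W : normedModType R).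
Implicit Types (f g : V -> W) (p v : V) (O : set V).

Lemma differentiable_of_littleo f (df : {linear V -> W}) p :
  continuous df -> f \o shift p = cst (f p) + df +o_ 0 id ->
  differentiable f p.
Proof.
move=> dfc dxf; have E := diff_unique dfc dxf.
by apply/diff_locallyP; split; [move=> x; rewrite E; exact: dfc|rewrite E].
Qed.

Lemma differentiable_small f p :
  (forall e : R, 0 < e ->
     \forall h \near (0 : V), `|f (p + h) - f p| <= e * `|h|) ->
  differentiable f p /\ forall v, 'D_v f p = 0.
Proof.
move=> small.
have z : f \o shift p = cst (f p) + (\0 : {linear V -> W}) +o_ 0 id.
  apply/eqaddoP => e e0; apply: filterS (small e e0) => h.
  by rewrite !fctE /= addr0 [h + p]addrC.
have z0 : continuous (\0 : {linear V -> W}) by move=> x; exact: cvg_cst.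
have df := differentiable_of_littleo z0 z.
by split=> // v; rewrite deriveE // (diff_unique z0 z).
Qed.

Lemma near_eq_differentiable f g p :
  (\near p, f p = g p) -> differentiable f p -> differentiable g p.
Proof.
move=> fg df.
have [dgf _] : differentiable (fun q => g q - f q) p /\
    forall v, 'D_v (fun q => g q - f q) p = 0.
  apply: differentiable_small => e e0.
  have : \forall h \near (0 : V), f (h + p) = g (h + p).
    by move: fg; rewrite (near_shift 0 p (fun x => f x = g x)) subr0.
  apply: filterS => h fgh.
  by rewrite (nbhs_singleton fg) [p + h]addrC fgh !subrr normr0 mulr_ge0 // ltW.
have -> : g = (fun q => g q - f q) + f by apply/funext => q; rewrite fctE subrK.
exact: differentiableD.
Qed.

End Differentiability.

Section Smoothness.
Variables (R : realType) (V : normedModType R).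
Implicit Types (f g : V -> R) (p v : V) (O : set V).

Lemma smooth_on_diff O f p : smooth_on O f -> O p -> differentiable f p.
Proof. by move=> fs; exact: (fs [::]). Qed.

Lemma smooth_on_derivable O f p v : smooth_on O f -> O p -> derivable f p v.
Proof. by move=> fs Op; apply: diff_derivable; exact: smooth_on_diff Op. Qed.

Lemma smooth_on_derive O f v : smooth_on O f -> smooth_on O ('D_v f).
Proof.
move=> fs s p Op; have := fs (rcons s v) p Op.
by rewrite /iter_derive foldr_rcons.
Qed.

Lemma open_eq_near O f g p : open O -> (forall q, O q -> f q = g q) -> O p ->
  \near p, f p = g p.
Proof. by move=> oO fg Op; apply: filterS (open_nbhs_nbhs (conj oO Op)). Qed.

Lemma open_eq_derive O f g p v : open O -> (forall q, O q -> f q = g q) ->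
  O p -> 'D_v f p = 'D_v g p.
Proof. by move=> oO fg Op; apply: near_eq_derive; exact: open_eq_near Op. Qed.

(** Coinduction: smooth_on is the largest class of functions that are
    differentiable on O and whose derivatives again belong to the class. *)
Lemma smooth_on_coind O (P : (V -> R) -> Prop) : open O ->
  (forall f p, P f -> O p -> differentiable f p) ->
  (forall f v, P f ->
     exists2 g, P g & forall p, O p -> 'D_v f p = g p) ->
  forall f, P f -> smooth_on O f.
Proof.
move=> oO Pd PD f Pf s.
suff [g Pg fg] : exists2 g, P g & forall q, O q -> iter_derive f s q = g q.
  move=> p Op; apply: (@near_eq_differentiable _ _ _ g); last exact: Pd.
  by apply: open_eq_near Op => // q /fg.
elim: s => [|v s [g Pg fg]]; first by exists f.
have [h Ph gh] := PD g v Pg; exists h => // q Oq.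
by rewrite /= (open_eq_derive _ oO fg Oq) gh.
Qed.

Lemma smooth_on_eq O f g : open O -> (forall p, O p -> f p = g p) ->
  smooth_on O f -> smooth_on O g.
Proof.
move=> oO fg fs.
apply: (@smooth_on_coind O (fun g => exists2 f, smooth_on O f &
    forall p, O p -> f p = g p)) => //; last by exists f.
- move=> {fg fs} {}g p [{}f fs fg] Op.
  by apply: near_eq_differentiable (smooth_on_diff fs Op);
    exact: open_eq_near Op.
- move=> {fg fs} {}g v [{}f fs fg].
  exists ('D_v g) => //; exists ('D_v f); first exact: smooth_on_derive.
  by move=> p; exact: open_eq_derive.
Qed.

Lemma smooth_on_cst O (c : R) : open O -> smooth_on O (fun=> c).
Proof.
move=> oO.
apply: (@smooth_on_coind O (fun f => exists c, f = fun=> c)) => //.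
- by move=> _ p [{}c ->] _; exact: differentiable_cst.
- move=> _ v [{}c ->]; exists (fun=> 0); first by exists 0.
  by move=> p _; rewrite derive_cst.
- by exists c.
Qed.

Lemma smooth_on_add O f g : open O -> smooth_on O f -> smooth_on O g ->
  smooth_on O (fun p => f p + g p).
Proof.
move=> oO fs gs.
apply: (@smooth_on_coind O (fun h => exists f g, [/\ smooth_on O f,
  smooth_on O g & h = fun p => f p + g p])) => //; last by exists f, g.
- move=> _ p [{fs}f [{gs}g [fs gs ->]]] Op.
  by apply: differentiableD; exact: smooth_on_diff Op.
- move=> _ v [{fs}f [{gs}g [fs gs ->]]].
  exists (fun p => 'D_v f p + 'D_v g p).
    by exists ('D_v f), ('D_v g); split=> //; exact: smooth_on_derive.
  by move=> p Op; rewrite deriveD //; exact: smooth_on_derivable Op.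
Qed.

Lemma smooth_on_sum O (I : Type) (s : seq I) (P : pred I) (F : I -> V -> R) :
  open O -> (forall i, smooth_on O (F i)) ->
  smooth_on O (fun p => \sum_(i <- s | P i) F i p).
Proof.
move=> oO Fs; elim: s => [|i s IH].
  by apply: smooth_on_eq (smooth_on_cst 0 oO) => // p _; rewrite big_nil.
case Pi : (P i); last first.
  by apply: smooth_on_eq IH => // p _; rewrite big_cons Pi.
apply: smooth_on_eq (smooth_on_add oO (Fs i) IH) => // p _.
by rewrite big_cons Pi.
Qed.

(** The class used to see that products are smooth: products alone are not stable
    under derivation, sums of products are. *)
Inductive sum_of_products O : (V -> R) -> Prop :=
| SumOfProducts_mul f g : smooth_on O f -> smooth_on O g ->
    sum_of_products O (fun p => f p * g p)
| SumOfProducts_add f g : sum_of_products O f -> sum_of_products O g ->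
    sum_of_products O (fun p => f p + g p).

Lemma smooth_on_mul O f g : open O -> smooth_on O f -> smooth_on O g ->
  smooth_on O (fun p => f p * g p).
Proof.
move=> oO fs gs.
have diffP h p : sum_of_products O h -> O p -> differentiable h p.
  move=> Ph Op; elim: Ph => {fs gs} {}f {}g.
    move=> fs gs.
    by apply: differentiableM; [exact: smooth_on_diff fs Op|exact:
      smooth_on_diff gs Op].
  by move=> _ df _ dg; apply: differentiableD.
apply: (@smooth_on_coind O (sum_of_products O)) => //;
  last exact: SumOfProducts_mul.
move=> h v; elim=> {fs gs} {}f {}g.
- move=> fs gs; exists (fun p => f p * 'D_v g p + g p * 'D_v f p).
    by apply: SumOfProducts_add; apply: SumOfProducts_mul => //;
      exact: smooth_on_derive.
  move=> p Op; rewrite deriveM //;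
    [exact: smooth_on_derivable fs Op|exact: smooth_on_derivable gs Op].
- move=> Pf [f' Pf' f'E] Pg [g' Pg' g'E].
  exists (fun p => f' p + g' p); first exact: SumOfProducts_add.
  move=> p Op; rewrite deriveD ?f'E ?g'E //; apply: diff_derivable;
    exact: diffP.
Qed.

Lemma smooth_on_scale O (c : R) f : open O -> smooth_on O f ->
  smooth_on O (fun p => c * f p).
Proof. by move=> oO; apply: smooth_on_mul => //; exact: smooth_on_cst. Qed.

End Smoothness.

Section Matrices.
Variables (R : realType) (a b : nat).
Local Notation V := 'M[R]_(a, b).
Implicit Types (p q u v : V) (O : set V).

Lemma derive_linear (f : V -> R) p c u v : differentiable f p ->
  'D_(c *: u + v) f p = c * 'D_u f p + 'D_v f p.
Proof. by move=> df; rewrite !deriveE // linearP. Qed.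

Lemma derive_basis (f : V -> R) p v : differentiable f p ->
  'D_v f p = \sum_i \sum_j v i j * 'D_(delta_mx i j) f p.
Proof.
move=> df; rewrite deriveE // {1}[v]matrix_sum_delta linear_sum.
apply: eq_bigr => i _; rewrite linear_sum; apply: eq_bigr => j _.
by rewrite linearZ deriveE.
Qed.

Lemma linear_mx_differentiable (W : normedModType R) (A : V -> W) p :
  linear A -> differentiable A p.
Proof.
move=> lA; pose A' := GRing.isLinear.Build _ _ _ _ A lA.
pose B : {linear V -> W} := HB.pack A A'.
have -> : A = \sum_i (\sum_j (fun q : V => q i j *: A (delta_mx i j))).
  apply/funext => q; rewrite fct_sumE [in LHS](matrix_sum_delta q).
  rewrite -[A]/(B : V -> W) linear_sum; apply: eq_bigr => i _.
  by rewrite fct_sumE linear_sum; apply: eq_bigr => j _; rewrite linearZ.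
apply: differentiable_sum => i; apply: differentiable_sum => j.
exact/differentiableZl/differentiable_coord.
Qed.

Lemma linear_mx_derive (W : normedModType R) (A : V -> W) p v :
  linear A -> 'D_v A p = A v.
Proof.
move=> lA; pose A' := GRing.isLinear.Build _ _ _ _ A lA.
pose B : {linear V -> W} := HB.pack A A'.
rewrite -[A]/(B : V -> W) deriveE; last exact: linear_mx_differentiable.
by rewrite diff_lin // => x; exact/differentiable_continuous/linear_mx_differentiable.
Qed.

Lemma smooth_on_linear O (A : V -> R) : open O -> linear A -> smooth_on O A.
Proof.
move=> oO lA.
apply: (@smooth_on_coind _ _ O (fun f => linear f \/ exists c, f =
  cst c)) => //.
- move=> f p [lf|[c ->]] _; first exact: linear_mx_differentiable.
  exact: differentiable_cst.
- move=> f v [lf|[c ->]].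
    by exists (cst (f v)); [right; exists (f v)|move=> p _;
      exact: linear_mx_derive].
  exists (cst 0); first by right; exists 0.
  by move=> p _; rewrite derive_cst.
- by left.
Qed.

End Matrices.

Section Pullback.
Variables (R : realType) (a b a' b' : nat).
Local Notation V := 'M[R]_(a, b).
Local Notation V' := 'M[R]_(a', b').
Variables (A : V -> V') (lA : linear A).

Lemma derive_comp_linear (f : V' -> R) p v : differentiable f (A p) ->
  'D_v (fun q => f (A q)) p = 'D_(A v) f (A p).
Proof.
move=> df; have dA := linear_mx_differentiable p lA.
rewrite deriveE; last exact: differentiable_comp.
by rewrite diff_comp //= -(deriveE v dA) linear_mx_derive // deriveE.
Qed.

Lemma smooth_on_comp_linear (O : set V) (O' : set V') (f : V' -> R) :
  open O ->
  (forall p, O p -> O' (A p)) -> smooth_on O' f ->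
  smooth_on O (fun p => f (A p)).
Proof.
move=> oO OO' fs.
apply: (@smooth_on_coind _ _ O (fun h =>
  exists2 f : V' -> R, smooth_on O' f & h = fun p => f (A p))) => //;
  last by exists f.
- move=> _ p [{fs}f fs ->] Op; apply: differentiable_comp.
    exact: linear_mx_differentiable.
  exact: smooth_on_diff fs (OO' _ Op).
- move=> _ v [{fs}f fs ->].
  exists (fun p => 'D_(A v) f (A p)).
    by exists ('D_(A v) f) => //; exact: smooth_on_derive.
  by move=> p Op; rewrite derive_comp_linear //;
    exact: smooth_on_diff fs (OO' _ Op).
Qed.

End Pullback.

(** * Strict differentiability and the symmetry of second derivatives *)

Section LineMVT.
Variables (R : realType) (V : normedModType R).
Implicit Types (f : V -> R) (p v : V).

Lemma derive_line f p v (t : R) : differentiable f (p + t *: v) ->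
  is_derive t 1 (fun s : R => f (p + s *: v)) ('D_v f (p + t *: v)).
Proof.
move=> df; have dv : derivable f (p + t *: v) v by exact: diff_derivable.
have E : (fun h : R => h^-1 *: (f (p + (h *: (1 : R) + t) *: v) - f (p + t *:
  v)))
  = (fun h : R => h^-1 *: (f (h *: v + (p + t *: v)) - f (p + t *: v))).
  apply/funext => h; congr (_ *: (f _ - _)).
  by rewrite [h *: 1]mulr1 scalerDl addrCA.
by split; [move: dv; rewrite /derivable /= -E|rewrite /derive /= E].
Qed.

Lemma MVT_line f p v : (forall t : R, 0 <= t <= 1 ->
  differentiable f (p + t *: v)) ->
  exists2 t : R, 0 <= t <= 1 & f (p + v) - f p = 'D_v f (p + t *: v).
Proof.
move=> df.
have [||t] := @MVT_segment R (fun s => f (p + s *: v))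
    (fun s => 'D_v f (p + s *: v)) 0 1 ler01.
- by move=> t /[!in_itv]/= /andP[t0 t1]; apply/derive_line/df; rewrite !ltW.
- apply: continuous_in_subspaceT => t; rewrite inE /= in_itv /= => t01.
  apply: differentiable_continuous; apply/derivable1_diffP.
  by have [] := derive_line (df t t01).
- rewrite in_itv /= => t01; rewrite scale1r scale0r addr0 subr0 mulr1 => ->.
  by exists t.
Qed.

End LineMVT.

Section C1.
Variables (R : realType) (a b : nat).
Local Notation V := 'M[R]_(a, b).
Implicit Types (p q h v : V) (O : set V).

Lemma ler_mx_coord (h : V) i j : `|h i j| <= `|h|.
Proof.
rewrite [X in _ <= X](_ : `|h| = mx_norm h) // mx_normrE.
exact: (le_bigmax _ (fun ij : 'I_a * 'I_b => `|h ij.1 ij.2|) (i, j)).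
Qed.

(** The mean value theorem between q and q + h, where the partial derivatives
    are close to their values at p. *)
Lemma strict_diff (f : V -> R) O p : open O -> O p ->
  (forall q, O q -> differentiable f q) ->
  (forall v, {for p, continuous ('D_v f)}) ->
  forall e : R, 0 < e -> \forall q \near p & h \near (0 : V),
    `|f (q + h) - f q - 'D_h f q| <= e * `|h|.
Proof.
move=> oO Op df cD e e0.
(* the error e is shared out between the a * b coordinates, and between the
   two comparisons with the derivative at p *)
pose M : R := ((a * b).+1)%:R.
have M0 : 0 < M by rewrite ltr0n.
pose e' := e / M / 2.
have e'0 : 0 < e' by rewrite !divr_gt0.
have near_p : \forall x \near p, O x /\ forall i j,
    `|'D_(delta_mx i j) f x - 'D_(delta_mx i j) f p| < e'.
  apply: filterI; first exact: open_nbhs_nbhs.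
  have near_ij (i : 'I_a) (j : 'I_b) : \forall x \near p,
      `|'D_(delta_mx i j) f x - 'D_(delta_mx i j) f p| < e'.
    have /cvgrPdist_lt /(_ e' e'0) := cD (delta_mx i j).
    by apply: filterS => x; rewrite distrC.
  have near_i i := filter_forall (nbhs_filter p) (near_ij i).
  exact: filter_forall (nbhs_filter p) near_i.
have /nbhs_ballP [d /= d0 dB] := near_p.
near=> q h.
have hq : `|p - q| < d / 2.
  by near: q; apply: (@cvgr_dist_lt _ _ _ _ _ id p);
    [exact: cvg_id|rewrite divr_gt0].
have hh : `|h| < d / 2.
  near: h; apply: (@cvgr0_norm_lt _ _ _ _ _ id); first exact: cvg_id.
  by rewrite divr_gt0.
have inB t : 0 <= t <= 1 -> ball p d (q + t *: h).
  move=> /andP[t0 t1]; rewrite -ball_normE /= opprD addrA.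
  rewrite (le_lt_trans (ler_normB _ _)) // (splitr d) ltr_leD // normrZ
    ger0_norm //.
  by rewrite (le_trans (ler_piMl _ _)) // ltW.
have [|t t01 ->] := @MVT_line _ _ f q h.
  by move=> t t01; apply: df; case: (dB _ (inB t t01)).
have Bq : ball p d q by have := inB 0; rewrite lexx ler01 scale0r addr0; apply.
have [Oq Dq] := dB q Bq.
have [Ox Dx] := dB _ (inB t t01).
rewrite !(derive_basis _ (df _ _)) // -sumrB (le_trans (ler_norm_sum _ _ _)) //.
have -> : e * `|h| = \sum_(i < a) \sum_(j < b) (`|h| * (e' * 2)) + `|h| * (e' *
  2).
  rewrite !sumr_const !card_ord -mulrnA mulnC -mulrSr /e' divfK // -mulr_natr
    -/M.
  by rewrite -mulrA divfK ?gt_eqF // mulrC.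
apply: ler_wpDr; first by rewrite mulr_ge0 // mulr_ge0 // ltW.
apply: ler_sum => i _; rewrite -sumrB (le_trans (ler_norm_sum _ _ _)) //.
apply: ler_sum => j _; rewrite -mulrBr normrM ler_pM //.
  exact: ler_mx_coord.
have -> : e' * 2 = e' + e' by rewrite mulr_natr mulr2n.
rewrite (le_trans (ler_distD ('D_(delta_mx i j) f p) _ _)) // lerD // ltW //.
by rewrite distrC.
Unshelve. all: by end_near. Qed.

End C1.

Section Schwarz.
Variables (R : realType) (V : normedModType R).
Implicit Types (f : V -> R) (p u v : V) (O : set V).

Lemma diff_small f p e : differentiable f p -> 0 < e ->
  \forall x \near (0 : V), `|f (p + x) - f p - 'D_x f p| <= e * `|x|.
Proof.
move=> df e0; have /eqaddoP /(_ e e0) := diff_locally df.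
apply: filterS => x /=; rewrite !fctE /= deriveE // opprD addrA.
by rewrite [x + p]addrC.
Qed.

Lemma derive_translate f p u v :
  'D_u (fun x => f (x + v)) p = 'D_u f (p + v).
Proof.
rewrite /derive; set F := fun h : R => _; set G := fun h : R => _.
suff -> : F = G by [].
by apply/funext => h; rewrite /F /G /= addrA.
Qed.

Let second_diff f p u v (t : R) :=
  f (p + t *: u + t *: v) - f (p + t *: u) - (f (p + t *: v) - f p).

(** One mean value step turns the second difference into t times an increment of
    the derivative along u, to which differentiability at p applies. *)
Let second_diff_approx O f p u v e : open O -> O p -> smooth_on O f -> 0 < e ->
  \forall t \near (0 : R)^'+,
    `|second_diff f p u v t - t ^+ 2 * 'D_v ('D_u f) p| <=
      e * (2 * `|u| + 2 * `|v|) * t ^+ 2.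
Proof.
move=> oO Op fs e0; set g := 'D_u f.
have dg : differentiable g p by apply: smooth_on_diff Op;
  exact: smooth_on_derive.
have O0 : \forall x \near (0 : V), O (p + x) /\
    `|g (p + x) - g p - 'D_x g p| <= e * `|x|.
  apply: filterI; last exact: diff_small.
  have : \near p, O p by apply: open_nbhs_nbhs.
  by rewrite (near_shift 0 p) subr0; apply: filterS => x /=; rewrite addrC.
have /nbhs_ballP [d /= d0 dB] := O0.
near=> t.
have t0 : 0 < t by [].
have small s s' : 0 <= s <= 1 -> 0 <= s' <= 1 ->
  ball 0 d (s *: (t *: u) + s' *: (t *: v)).
  move=> /andP[s0 s1] /andP[s'0 s'1].
  rewrite -ball_normE /= sub0r normrN (le_lt_trans (ler_normD _ _)) //.
  rewrite !normrZ !ger0_norm // 2?ltW //.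
  have : t * `|u| + t * `|v| < d.
    have : t < d / (`|u| + `|v| + 1).
      by near: t; apply: nbhs_right_lt;
        rewrite divr_gt0 // ltr_wpDl // addr_ge0.
    rewrite ltr_pdivlMr ?ltr_wpDl ?addr_ge0 // => h.
    by rewrite -mulrDr (le_lt_trans _ h) // ler_pM2l // lerDl.
  apply: le_lt_trans; apply: lerD; apply: ler_piMl => //; apply: mulr_ge0 => //;
    exact: ltW.
have le01 : (0 <= (1 : R) <= 1) by rewrite ler01 lexx.
have le00 : (0 <= (0 : R) <= 1) by rewrite ler01 lexx.
pose phi x := f (x + t *: v) - f x.
have dphi s : 0 <= s <= 1 -> is_derive (p + s *: (t *: u)) (t *: u) phi
    (t * (g (p + s *: (t *: u) + t *: v) - g (p + s *: (t *: u)))) /\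
    differentiable phi (p + s *: (t *: u)).
  move=> s01; set y := p + s *: (t *: u).
  have Oy : O y.
    by have [] := dB _ (small s 0 s01 le00); rewrite scale0r addr0.
  have Oyv : O (y + t *: v).
    by have [] := dB _ (small s 1 s01 le01); rewrite scale1r addrA.
  have dfy : differentiable f y by exact: smooth_on_diff Oy.
  have dfyv : differentiable (fun x => f (x + t *: v)) y.
    apply: (@differentiable_comp _ _ _ _ (fun x => x + t *: v)) => //.
    exact: smooth_on_diff Oyv.
  split; last exact: differentiableB.
  split; first by apply: diff_derivable; exact: differentiableB.
  rewrite deriveB; [|exact: diff_derivable..].
  rewrite derive_translate mulrBr /g.
  by rewrite !deriveE ?linearZ //; exact: smooth_on_diff Oyv.
have [s s01] : exists2 s : R, 0 <= s <= 1 & second_diff f p u v t =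
    t * (g (p + s *: (t *: u) + t *: v) - g (p + s *: (t *: u))).
  have [|s s01 E] := @MVT_line _ _ phi p (t *: u).
    by move=> s s01; case: (dphi s s01).
  exists s => //; have [[_ <-] _] := dphi s s01; rewrite -E /phi /second_diff.
  by [].
move=> ->.
have [_ h1] := dB _ (small s 1 s01 le01).
have [_ h2] := dB _ (small s 0 s01 le00).
move: h1 h2; rewrite scale1r scale0r addr0 !addrA.
set x := s *: (t *: u); set y := t *: v => h1 h2.
have -> : t ^+ 2 * 'D_v g p = t * 'D_y g p.
  by rewrite !deriveE // /y linearZ expr2 mulrA.
have Dxy : 'D_(x + y) g p = 'D_x g p + 'D_y g p by rewrite !deriveE // linearD.
rewrite -mulrBr normrM gtr0_norm // expr2 mulrCA ler_pM2l //.
have -> : g (p + x + y) - g (p + x) - 'D_y g p =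
  (g (p + x + y) - g p - 'D_(x + y) g p) - (g (p + x) - g p - 'D_x g p).
  rewrite Dxy; move: (g (p + x + y)) (g (p + x)) (g p) ('D_x g p) ('D_y g p).
  by move=> a1 a2 a3 a4 a5; ring.
apply: (le_trans (ler_normB _ _)); apply: (le_trans (lerD h1 h2)).
rewrite -mulrDr -mulrA ler_pM2l //.
have hx : `|x| <= `|u| * t.
  case/andP: s01 => s0 s1.
  by rewrite !normrZ ger0_norm // (gtr0_norm t0) mulrC [`|u| * t]mulrC ler_piMr
    // mulr_ge0 // ltW.
have hy : `|y| <= `|v| * t by rewrite normrZ gtr0_norm // mulrC.
have hv : 0 <= `|v| * t by rewrite mulr_ge0 // ltW.
rewrite mulrDl -!mulrA; have := ler_normD x y.
move: hx hy hv; clear; move: (`|v| * t) (`|u| * t) (`|x + y|) (`|x|) (`|y|).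
by move=> *; lra.
Unshelve. all: by end_near. Qed.

(** Both sides are the limit of the second difference of f along t u and t v,
    divided by t ^ 2, and that difference is symmetric in u and v. *)
Lemma schwarz O f p u v : open O -> O p -> smooth_on O f ->
  'D_u ('D_v f) p = 'D_v ('D_u f) p.
Proof.
move=> oO Op fs; apply/eqP; rewrite -subr_eq0 -normr_le0.
apply/ler_addgt0Pr => e e0; rewrite add0r.
(* e' makes the errors of the two approximations add up to at most e t ^ 2 *)
pose C := 2 * `|u| + 2 * `|v| + 1.
have C0 : 0 < C by rewrite /C ltr_wpDl // addr_ge0 // mulr_ge0.
pose e' := e / (2 * C).
have e'0 : 0 < e' by rewrite divr_gt0 // mulr_gt0.
have h1 := second_diff_approx u v oO Op fs e'0.
have h2 := second_diff_approx v u oO Op fs e'0.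
near (0 : R)^'+ => t.
have t0 : 0 < t by [].
have H1 : `|second_diff f p u v t - t ^+ 2 * 'D_v ('D_u f) p| <=
  e' * (2 * `|u| + 2 * `|v|) * t ^+ 2 by near: t.
have H2 : `|second_diff f p v u t - t ^+ 2 * 'D_u ('D_v f) p| <=
  e' * (2 * `|v| + 2 * `|u|) * t ^+ 2 by near: t.
have E : second_diff f p v u t = second_diff f p u v t.
  rewrite /second_diff (addrAC p (t *: v)).
  move: (f _) (f _) (f _) (f _) => a1 a2 a3 a4; ring.
have t20 : 0 < t ^+ 2 by rewrite exprn_gt0.
rewrite -(ler_pM2l t20) -{1}(gtr0_norm t20) -normrM mulrBr.
rewrite (_ : _ - _ = (second_diff f p u v t - t ^+ 2 * 'D_v ('D_u f) p)
  - (second_diff f p v u t - t ^+ 2 * 'D_u ('D_v f) p)); last first.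
  rewrite E; move: (second_diff _ _ _ _ _) ('D_u _ _) ('D_v _ _) => a1 a2 a3;
    ring.
apply: (le_trans (ler_normB _ _)); apply: (le_trans (lerD H1 H2)).
rewrite [_ + 2 * `|u|]addrC -mulrDl mulrC ler_pM2l //.
have -> : e = e' * C + e' * C by rewrite /e'; field; rewrite gt_eqF.
by rewrite lerD // ler_pM2l // lerDl.
Unshelve. all: by end_near. Qed.

End Schwarz.

(** * Integrals along the segments from the centre of a ball *)

Section UnitIntegral.
Variable R : realType.
Implicit Types g h F : R -> R.

Definition cont01 g := forall t, 0 <= t <= 1 -> {for t, continuous g}.
Definition int01 g : R := \int[lebesgue_measure]_(t in `[0, 1]) g t.

Lemma cont01_within g : cont01 g -> {within `[0, 1], continuous g}.
Proof.
move=> cg; apply: continuous_in_subspaceT => t; rewrite inE /= in_itv /=.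
exact: cg.
Qed.

Lemma cont01_integrable g : cont01 g ->
  lebesgue_measure.-integrable `[0, 1] (EFin \o g).
Proof.
move=> cg; apply: continuous_compact_integrable; first exact: segment_compact.
exact: cont01_within.
Qed.

Lemma eq_int01 g h : (forall t, 0 <= t <= 1 -> g t = h t) -> int01 g = int01 h.
Proof.
move=> gh; apply: eq_Rintegral => t; rewrite inE /= in_itv /=; exact: gh.
Qed.

Lemma int01D g h : cont01 g -> cont01 h ->
  int01 (fun t => g t + h t) = int01 g + int01 h.
Proof. by move=> cg ch; rewrite /int01 RintegralD //;
  exact: cont01_integrable. Qed.

Lemma int01Z k g : cont01 g -> int01 (fun t => k * g t) = k * int01 g.
Proof. by move=> cg; rewrite /int01 RintegralZl //;
  exact: cont01_integrable. Qed.

Lemma cont01_cst k : cont01 (fun=> k).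
Proof. by move=> t _; exact: cvg_cst. Qed.

Lemma int01_cst k : int01 (fun=> k) = k.
Proof.
rewrite /int01 Rintegral_cst //= lebesgue_measure_itv /= lte_fin ltr01.
by rewrite oppr0 adde0 mulr1.
Qed.

Lemma ler_int01 g k : cont01 g -> (forall t, 0 <= t <= 1 -> `|g t| <= k) ->
  `|int01 g| <= k.
Proof.
move=> cg gk; rewrite -[k]int01_cst.
apply: (le_trans (le_normr_Rintegral _ (cont01_integrable cg))) => //.
apply: le_Rintegral => //.
- exact: (cont01_integrable (fun t t01 => @continuous_comp _ _ _ g Num.norm t
  (cg t t01) (@norm_continuous _ _ _))).
- exact: (cont01_integrable (@cont01_cst k)).
Qed.

Lemma int01_FTC g F : cont01 g -> (forall t : R, 0 <= t <= 1 ->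
  is_derive t 1 F (g t)) ->
  int01 g = F 1 - F 0.
Proof.
move=> cg dF; rewrite /int01 /Rintegral (@continuous_FTC2 _ g F) //.
- exact: cont01_within.
- have cF (t : R) : 0 <= t <= 1 -> {for t, continuous F}.
    by move=> /dF [dFt _]; apply/differentiable_continuous/derivable1_diffP.
  split.
  + by move=> t /[!in_itv]/= /andP[t0 t1]; have [] : is_derive t 1 F (g t)
      by apply: dF; rewrite !ltW.
  + by apply: cvg_at_right_filter; apply: cF; rewrite lexx ler01.
  + by apply: cvg_at_left_filter; apply: cF; rewrite lexx ler01.
- move=> t /[!in_itv]/= /andP[t0 t1]; rewrite derive1E.
  by have [_ ->] : is_derive t 1 F (g t) by apply: dF; rewrite !ltW.
Qed.

End UnitIntegral.

Section ConeIntegral.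
Variables (R : realType) (a b : nat).
Local Notation V := 'M[R]_(a, b).
Variables (c : V) (e : R).
Implicit Types (f : V -> R) (p q h v : V).
Local Notation B := (ball c e).

Lemma open_ballc : open B.
Proof. exact: ball_open. Qed.

Definition seg p (t : R) := c + t *: (p - c).

(** The operator by which the Poincare homotopy acts on the coefficients of a
    form; k accounts for the scaling of the arguments. *)
Definition cone (k : nat) f p : R := int01 (fun t => t ^+ k * f (seg p t)).

Lemma seg_ball p t : B p -> 0 <= t <= 1 -> B (seg p t).
Proof.
rewrite -!ball_normE /= /seg => pc /andP[t0 t1].
rewrite opprD addrA subrr sub0r normrN normrZ ger0_norm //.
by rewrite (le_lt_trans _ pc) // distrC ler_piMl.
Qed.

Lemma cont01_cone k f p : smooth_on B f -> B p ->
  cont01 (fun t => t ^+ k * f (seg p t)).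
Proof.
move=> fs Bp t t01.
have ct : {for t, continuous (seg p)}.
  by apply: cvgD; [exact: cvg_cst|apply: cvgZr_tmp; exact: cvg_id].
apply: cvgM; first exact: exprn_continuous.
apply: continuous_comp => //.
by apply: differentiable_continuous; exact: smooth_on_diff (seg_ball Bp t01).
Qed.

Lemma coneD k f g p : smooth_on B f -> smooth_on B g -> B p ->
  cone k (fun q => f q + g q) p = cone k f p + cone k g p.
Proof.
move=> fs gs Bp; rewrite /cone -int01D; [|exact: cont01_cone..].
by apply: eq_int01 => t _; rewrite mulrDr.
Qed.

Lemma coneZ k x f p : smooth_on B f -> B p ->
  cone k (fun q => x * f q) p = x * cone k f p.
Proof.
move=> fs Bp; rewrite /cone -int01Z; last exact: cont01_cone.
by apply: eq_int01 => t _; rewrite mulrCA.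
Qed.

Lemma eq_cone k f g p : (forall q, B q -> f q = g q) -> B p ->
  cone k f p = cone k g p.
Proof. by move=> fg Bp; apply: eq_int01 => t t01; rewrite fg //;
  exact: seg_ball. Qed.

Lemma cone_sum k (I : Type) (s : seq I) (F : I -> V -> R) p :
  (forall i, smooth_on B (F i)) -> B p ->
  cone k (fun q => \sum_(i <- s) F i q) p = \sum_(i <- s) cone k (F i) p.
Proof.
move=> Fs Bp; elim: s => [|i s IH].
  rewrite big_nil -[RHS](mul0r (cone k (fun=> 0) p)) -coneZ //; last first.
    exact: smooth_on_cst open_ballc.
  by apply: eq_cone => // q _; rewrite big_nil mul0r.
rewrite big_cons -IH -coneD //; last exact: smooth_on_sum open_ballc _.
by apply: eq_cone => // q _; rewrite big_cons.
Qed.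

Lemma seg_translate p h t : seg (p + h) t = seg p t + t *: h.
Proof. by rewrite /seg addrAC scalerDr addrA. Qed.

(** Differentiation under the integral sign: strict differentiability makes
    the remainder of f uniformly small along the compact segment from c to p. *)
Lemma cone_diff k f p : smooth_on B f -> B p ->
  differentiable (cone k f) p /\
  forall v, 'D_v (cone k f) p = cone k.+1 ('D_v f) p.
Proof.
move=> fs Bp.
pose A v : R := \sum_i \sum_j v i j * cone k.+1 ('D_(delta_mx i j) f) p.
have AE v : A v = cone k.+1 ('D_v f) p.
  have Ds i j : smooth_on B (fun q => v i j * 'D_(delta_mx i j) f q).
    exact: smooth_on_scale open_ballc (smooth_on_derive _ fs).
  rewrite /A -(@eq_cone k.+1 (fun q => \sum_i \sum_j v i j * 'D_(delta_mx i j) f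
    q)) //; last first.
    by move=> q Bq; rewrite -derive_basis //; exact: smooth_on_diff Bq.
  rewrite cone_sum //; last by move=> i; exact: smooth_on_sum open_ballc _.
  apply: eq_bigr => i _; rewrite cone_sum //; apply: eq_bigr => j _.
  by rewrite coneZ //; exact: smooth_on_derive.
have lA : linear A.
  move=> x u v; rewrite /A scaler_sumr -big_split /=; apply: eq_bigr => i _.
  rewrite scaler_sumr -big_split /=; apply: eq_bigr => j _.
  by rewrite !mxE mulrDl -mulrA.
have small : forall e', 0 < e' -> \forall h \near (0 : V),
    `|cone k f (p + h) - cone k f p - A h| <= e' * `|h|.
  move=> e' e'0.
  have K : \forall h \near (0 : V), forall t : R, `[0, 1]%classic t ->
      `|f (seg p t + t *: h) - f (seg p t) - 'D_(t *: h) f (seg p t)| <= e' *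
        `|t *: h|.
    have cov := (compact_near_coveringP `[0 : R,
      1]%classic).1 (@segment_compact _ 0 1).
    apply: (cov _ (nbhs (0 : V)) (fun h t =>
      `|f (seg p t + t *: h) - f (seg p t) - 'D_(t *: h) f (seg p t)| <= e' *
        `|t *: h|)) => t.
    rewrite /= in_itv /= => t01.
    have Bt := seg_ball Bp t01.
    have cD v : {for seg p t, continuous ('D_v f)}.
      apply: differentiable_continuous; apply: smooth_on_diff Bt.
      exact: smooth_on_derive.
    have sd := strict_diff open_ballc Bt (fun q Bq => smooth_on_diff fs Bq) cD
      e'0.
    have ct : {for t, continuous (seg p)}.
      by apply: cvgD; [exact: cvg_cst|apply: cvgZr_tmp; exact: cvg_id].
    have cs : (fun x : R * V => x.1 *: x.2) @ (nbhs t,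
      nbhs (0 : V)) --> (0 : V).
      rewrite -[X in _ --> X](scaler0 _ t).
      by apply: cvgZ; [exact: cvg_fst|exact: cvg_snd].
    have c1 : (fun x : R * V => seg p x.1) @ (nbhs t, nbhs (0 : V)) --> seg p t.
      by apply: (cvg_comp _ _ cvg_fst); exact: ct.
    exact: (cvg_pair c1 cs sd).
  have Bph : \forall h \near (0 : V), B (p + h).
    have : \near p, B p by apply: open_nbhs_nbhs; split=> //; exact: open_ballc.
    by rewrite (near_shift 0 p) subr0; apply: filterS => x /=; rewrite addrC.
  near=> h.
  have Bh : B (p + h) by near: h.
  have Kh t : 0 <= t <= 1 -> `|f (seg p t + t *: h) - f (seg p t) - 'D_(t *: h)
    f (seg p t)| <= e' * `|t *: h|.
    move=> t01; have : `[0, 1]%classic t by rewrite /= in_itv.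
    by move: t {t01}; near: h.
  have c1 := @cont01_cone k _ _ fs Bp; have c2 := @cont01_cone k _ _ fs Bh.
  have c3 := @cont01_cone k.+1 _ _ (smooth_on_derive h fs) Bp.
  have c1' : cont01 (fun t => -1 * (t ^+ k * f (seg p t))).
    by move=> t t01; apply: cvgM; [exact: cvg_cst|exact: c1].
  have c3' : cont01 (fun t => -1 * (t ^+ k.+1 * 'D_h f (seg p t))).
    by move=> t t01; apply: cvgM; [exact: cvg_cst|exact: c3].
  have c12 : cont01 (fun t => t ^+ k * f (seg (p + h) t) + -1 * (t ^+ k * f (seg
    p t))).
    by move=> t t01; apply: cvgD; [exact: c2|exact: c1'].
  rewrite AE -[X in _ - X - _]mul1r -mulNr -[X in _ - X]mul1r -mulNr /cone.
  rewrite -!int01Z // -!int01D //; apply: ler_int01.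
    by move=> t t01; apply: cvgD; [exact: c12|exact: c3'].
  move=> t t01; rewrite seg_translate.
  have dt : differentiable f (seg p t) by exact: smooth_on_diff (seg_ball Bp
    t01).
  have -> : t ^+ k * f (seg p t + t *: h) + -1 * (t ^+ k * f (seg p t)) +
      -1 * (t ^+ k.+1 * 'D_h f (seg p t)) = t ^+ k *
      (f (seg p t + t *: h) - f (seg p t) - 'D_(t *: h) f (seg p t)).
    rewrite [in RHS]deriveE // linearZ /= -deriveE // exprSr.
    move: (f _) (f _) ('D_h _ _) => a1 a2 a3; rewrite [_ *: _]mulrC; ring.
  case/andP: t01 (Kh t t01) => t0 t1 Kt.
  rewrite normrM ger0_norm ?exprn_ge0 //.
  rewrite (le_trans (ler_piMl _ _)) ?exprn_ile1 // (le_trans Kt) //.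
  by rewrite ler_pM2l // normrZ ger0_norm // ler_piMl.
have dA q : differentiable A q by exact: linear_mx_differentiable.
pose r := cone k f - A.
have rE : cone k f = r + A by rewrite /r subrK.
have [dr Dr] : differentiable r p /\ forall v, 'D_v r p = 0.
  apply: differentiable_small => e' e'0; apply: filterS (small e' e'0) => h.
  rewrite /r !fctE; have -> : A (p + h) = A p + A h.
    by have := lA 1 p h; rewrite !scale1r.
  apply: le_trans; rewrite le_eqVlt; apply/orP; left; apply/eqP; congr `|_|.
  by move: (cone k f _) (cone k f _) (A p) (A h) => a1 a2 a3 a4; ring.
split; first by rewrite rE; exact: differentiableD.
move=> v; rewrite -AE rE deriveD; [|exact: diff_derivable..].
by rewrite Dr add0r linear_mx_derive.
Unshelve. all: by end_near. Qed.

Lemma smooth_on_cone k f : smooth_on B f -> smooth_on B (cone k f).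
Proof.
move=> fs.
pose P (h : V -> R) := exists l (g : V -> R), smooth_on B g /\ h = cone l g.
apply: (@smooth_on_coind R V B P open_ballc).
- by move=> _ p [l [g [gs ->]]] Bp; have [] := @cone_diff l _ _ gs Bp.
- move=> _ v [l [g [gs ->]]]; exists (cone l.+1 ('D_v g)).
    by exists l.+1, ('D_v g); split=> //; exact: smooth_on_derive.
  by move=> p Bp; have [_ ->] := @cone_diff l _ _ gs Bp.
- by exists k, f.
Qed.

(** The left-hand side is the integral over [0, 1] of the derivative of
    t ^ (k + 1) f (c + t (p - c)). *)
Lemma cone_euler k f p : smooth_on B f -> B p ->
  k.+1%:R * cone k f p + cone k.+1 ('D_(p - c) f) p = f p.
Proof.
move=> fs Bp.
have c1 := @cont01_cone k _ _ fs Bp.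
have c2 := @cont01_cone k.+1 _ _ (smooth_on_derive (p - c) fs) Bp.
have c1' : cont01 (fun t => k.+1%:R * (t ^+ k * f (seg p t))).
  by move=> t t01; apply: cvgM; [exact: cvg_cst|exact: c1].
have dF (t : R) : 0 <= t <= 1 -> is_derive t 1
    (fun t : R => t ^+ k.+1 * f (seg p t))
    (k.+1%:R * (t ^+ k * f (seg p t)) + t ^+ k.+1 * 'D_(p - c) f (seg p t)).
  move=> t01.
  have dt : differentiable f (seg p t) by exact: smooth_on_diff (seg_ball Bp
    t01).
  have d1 := derive_line dt.
  have d2 : is_derive t 1 (fun t : R => t ^+ k.+1) (k.+1%:R * t ^+ k).
    split; first exact: exprn_derivable.
    by rewrite exp_derive [LHS]mulr1.
  have := is_deriveM d2 d1.
  set F := (X in is_derive _ _ X _ -> _).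
  have -> : F = (fun t : R => t ^+ k.+1 * f (seg p t)) by apply/funext.
  move=> [dF DF]; split=> //; rewrite DF addrC; congr (_ + _).
  by rewrite [LHS]mulrCA; congr (_ * _); exact: mulrC.
rewrite /cone -int01Z // -int01D // (int01_FTC _ dF).
  by rewrite expr1n expr0n /= mul0r subr0 mul1r /seg scale1r addrC subrK.
by move=> t t01; apply: cvgD; [exact: c1'|exact: c2].
Qed.

End ConeIntegral.

(** * Replacing, deleting and moving arguments *)

Section Insertion.
Variable T : Type.

(** A constant, because the update notation is a coercion that hides its
    function from rewriting. *)
Definition upd r (v : 'I_r -> T) (j : 'I_r) (x : T) : 'I_r -> T :=
  [eta v with j |-> x].

Lemma updE r (v : 'I_r -> T) j x k :
  upd v j x k = if k == j then x else v k.
Proof. by []. Qed.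

Definition fcons r (x : T) (u : 'I_r -> T) : 'I_r.+1 -> T :=
  fun k => oapp u x (unlift ord0 k).

Lemma fcons0 r x (u : 'I_r -> T) : fcons x u ord0 = x.
Proof. by rewrite /fcons unlift_none. Qed.

Lemma fconsS r x (u : 'I_r -> T) k : fcons x u (lift ord0 k) = u k.
Proof. by rewrite /fcons liftK. Qed.

Lemma fcons_eta r (v : 'I_r.+1 -> T) :
  fcons (v ord0) (fun k => v (lift ord0 k)) = v.
Proof.
by apply/funext => k; case: (unliftP ord0 k) => [j|] ->;
  rewrite ?fconsS ?fcons0.
Qed.

Lemma fcons_lift r x (v : 'I_r.+1 -> T) i :
  (fun k => fcons x v (lift (lift ord0 i) k)) = fcons x (fun k => v (lift i k)).
Proof.
apply/funext => k; case: (unliftP ord0 k) => [j|] ->; last first.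
  rewrite fcons0 (_ : lift _ _ = ord0) ?fcons0 //; exact: val_inj.
rewrite fconsS (_ : lift _ _ = lift ord0 (lift i j)) ?fconsS //.
by apply: val_inj; rewrite /= /bump /=; lia.
Qed.

Lemma fcons_upd r x y (u : 'I_r -> T) j :
  fcons x (upd u j y) = upd (fcons x u) (lift ord0 j) y.
Proof.
apply/funext => k; case: (unliftP ord0 k) => [i|] ->.
  by rewrite !updE !fconsS (inj_eq lift_inj).
by rewrite updE !fcons0 (negPf (neq_lift _ _)).
Qed.

Lemma upd_lift_same r (v : 'I_r.+1 -> T) j x :
  (fun k => upd v j x (lift j k)) = (fun k => v (lift j k)).
Proof. by apply/funext => k; rewrite updE eq_sym (negPf (neq_lift _ _)). Qed.

Lemma upd_lift r (v : 'I_r.+1 -> T) i j x :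
  (fun k => upd v (lift i j) x (lift i k)) =
  upd (fun k => v (lift i k)) j x.
Proof. by apply/funext => k; rewrite updE (inj_eq lift_inj). Qed.

Lemma upd_same r (v : 'I_r -> T) j x : upd v j x j = x.
Proof. by rewrite updE eqxx. Qed.

Lemma upd_other r (v : 'I_r -> T) i j x : i != j -> upd v j x i = v i.
Proof. by rewrite updE => /negPf ->. Qed.

Lemma upd_id r (v : 'I_r -> T) j : upd v j (v j) = v.
Proof. by apply/funext => k; rewrite ?updE; case: eqP => // ->. Qed.

Lemma upd_upd r (v : 'I_r -> T) j x y :
  upd (upd v j x) j y = upd v j y.
Proof. by apply/funext => k; rewrite ?updE; case: eqP. Qed.

Lemma upd_comm r (v : 'I_r -> T) i j x y : i != j ->
  upd (upd v j x) i y = upd (upd v i y) j x.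
Proof.
by move=> ij; apply/funext => k; rewrite ?updE; case: eqP => // ->;
  rewrite (negPf ij).
Qed.

(** Deleting the entry i + 1 amounts to exchanging the entries i and i + 1 and
    deleting the entry i; this drives the induction that moves an argument to
    the front. *)
Lemma upd_swap_lift r (v : 'I_r.+2 -> T) (i : 'I_r.+1) :
  let i0 := widen_ord (leqnSn _) i in let i1 := lift ord0 i in
  (fun k => upd (upd v i0 (v i1)) i1 (v i0) (lift i0 k)) =
  (fun k => v (lift i1 k)).
Proof.
move=> i0 i1; apply/funext => k; rewrite ?updE; case: eqP => [E|/eqP N1].
  congr v; apply: val_inj; move/(congr1 val): E => /=; rewrite /bump /=; lia.
case: eqP => [/(congr1 val)/= |_]; first by rewrite /bump; lia.
congr v; apply: val_inj; move: N1; rewrite -val_eqE /= /bump /=; lia.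
Qed.

End Insertion.

(** Two entries can be deleted in two orders, which give the same family and
    opposite signs: the reason why the exterior derivative is alternating and
    squares to zero. *)
Lemma lift_lift r (a b : 'I_r.+2) (a' b' : 'I_r.+1) :
  a = lift b a' -> b = lift a b' ->
  (forall k, lift a (lift b' k) = lift b (lift a' k)) /\
  odd (a + b') = ~~ odd (b + a').
Proof.
move=> /(congr1 val) /= E1 /(congr1 val) /= E2; split.
  by move=> k; apply: val_inj => /=; move: E1 E2; rewrite /bump; lia.
move: E1 E2; rewrite /bump; case: ltnP; case: ltnP => /=; lia.
Qed.

(** * Differential forms on an open set *)

Section FormCalculus.
Variables (R : realType) (m n L : nat).
Local Notation J := 'M[R]_(n, nmi m L).
Local Notation form r := (Defs.form R m n r L).
Variables (O : set J) (oO : open O).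
Implicit Types (p q u x y : J).

Definition eq_form_on r (w w' : form r) := forall p v, O p -> w p v = w' p v.

Lemma is_formI r (w : form r) : (forall v, smooth_on O (fun p => w p v)) ->
  (forall p v j k x y, O p ->
    w p (upd v j (k *: x + y)) = k * w p (upd v j x) + w p (upd v j y)) ->
  (forall p v i j, O p -> i != j -> v i = v j -> w p v = 0) -> is_form O w.
Proof. by split. Qed.

Section Alternation.
Variables (r : nat) (w : form r).
Hypothesis fw : is_form O w.

Lemma form_smooth v : smooth_on O (fun p => w p v).
Proof. by case: fw. Qed.

Lemma form_linear p v j k x y : O p ->
  w p (upd v j (k *: x + y)) = k * w p (upd v j x) + w p (upd v j y).
Proof. by case: fw => _ lw _ Op; exact: lw. Qed.

Lemma form_alt p v i j : O p -> i != j -> v i = v j -> w p v = 0.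
Proof. by case: fw => _ _; apply. Qed.

Lemma form_argD p v j x y : O p ->
  w p (upd v j (x + y)) = w p (upd v j x) + w p (upd v j y).
Proof. by move=> Op; have := form_linear v j 1 x y Op;
  rewrite scale1r mul1r. Qed.

Lemma form0 p v j : O p -> v j = 0 -> w p v = 0.
Proof.
move=> Op vj; have := form_linear v j 1 0 0 Op.
by rewrite scaler0 addr0 mul1r -vj upd_id => /eqP;
  rewrite -subr_eq subrr eq_sym => /eqP.
Qed.

Lemma form_argZ p v j k x : O p -> w p (upd v j (k *: x)) = k * w p (upd v j x).
Proof.
move=> Op; have := form_linear v j k x 0 Op; rewrite addr0 => ->.
by rewrite (@form0 p (upd v j 0) j) ?addr0 // upd_same.
Qed.

Lemma form_swap p v i j x y : O p -> i != j ->
  w p (upd (upd v i x) j y) = - w p (upd (upd v i y) j x).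
Proof.
move=> Op ij.
have Z z : w p (upd (upd v i z) j z) = 0.
  by apply: (form_alt Op ij); rewrite upd_same upd_other // upd_same.
have C a b : upd (upd v i a) j b =
  upd (upd v j b) i a by rewrite upd_comm // eq_sym.
apply/eqP; rewrite -addr_eq0; apply/eqP.
have := Z (x + y); rewrite form_argD // !(C (x + y)) !form_argD // -!C !Z.
by rewrite add0r addr0 addrC.
Qed.

Lemma form_sum p v j (I : Type) (s : seq I) (F : I -> J) : O p ->
  w p (upd v j (\sum_(i <- s) F i)) = \sum_(i <- s) w p (upd v j (F i)).
Proof.
move=> Op; elim: s => [|i s IH]; last by rewrite !big_cons form_argD // IH.
by rewrite !big_nil; apply: (form0 (j := j)); rewrite ?upd_same.
Qed.

End Alternation.

(** The argument v i moves past the i arguments before it, changing the sign at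
    each step. *)
Lemma form_front r (w : form r.+1) p v (i : 'I_r.+1) : is_form O w -> O p ->
  w p (fcons (v i) (fun k => v (lift i k))) = (-1) ^+ i * w p v.
Proof.
case: r w v i => [|r] w v i fw Op.
  by rewrite ord1 expr0 mul1r fcons_eta.
case: i => i ir; elim: i ir v => [|i IH] ir v.
  rewrite expr0 mul1r -[in RHS](fcons_eta v).
  by have -> : Ordinal ir = ord0 by exact: val_inj.
pose i' := Ordinal (ir : (i < r.+1)%N).
have -> : Ordinal ir = lift ord0 i' by exact: val_inj.
set i0 := widen_ord (leqnSn _) i'; set i1 := lift ord0 i'.
have ne : i0 != i1 by rewrite -val_eqE /= /bump; lia.
pose v' := upd (upd v i0 (v i1)) i1 (v i0).
have -> : fcons (v i1) (fun k => v (lift i1 k)) =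
    fcons (v' i0) (fun k => v' (lift i0 k)).
  by rewrite -(upd_swap_lift v i') /v' (upd_other _ _ ne) upd_same.
have := IH (ltn_ord i0) v'.
have -> : Ordinal (ltn_ord i0) = i0 by exact: val_inj.
move=> ->; rewrite /v' (form_swap fw) // upd_id upd_id.
by rewrite mulrN exprS mulN1r mulNr.
Qed.

Lemma form_derivable r (w : form r) p u v : is_form O w -> O p ->
  derivable (fun q => w q v) p u.
Proof. by move=> fw Op; exact: smooth_on_derivable (form_smooth fw v) Op. Qed.

Lemma form_diff r (w : form r) p v : is_form O w -> O p ->
  differentiable (fun q => w q v) p.
Proof. by move=> fw Op; exact: smooth_on_diff (form_smooth fw v) Op. Qed.

Lemma derive_on0 (f : J -> R) p u : (forall q, O q -> f q = 0) -> O p ->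
  'D_u f p = 0.
Proof.
move=> f0 Op; rewrite (open_eq_derive u oO (g := fun=> 0)) //.
exact: derive_cst.
Qed.

Lemma is_form_eq r (w w' : form r) : eq_form_on w w' -> is_form O w ->
  is_form O w'.
Proof.
move=> ww' fw; split.
- by move=> v; apply: smooth_on_eq (form_smooth fw v) => // p Op; exact: ww'.
- by move=> p v j k a b Op; rewrite -!ww' //; case: fw => _ + _; apply.
- by move=> p v i j Op ij vij; rewrite -ww' //; exact: form_alt Op ij vij.
Qed.

Lemma is_form_lin r (w w' : form r) k : is_form O w -> is_form O w' ->
  is_form O (fun p v => k * w p v + w' p v).
Proof.
move=> fw fw'; apply: is_formI.
- move=> v; apply: smooth_on_add => //; last exact: form_smooth.
  by apply: smooth_on_scale => //; exact: form_smooth.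
- move=> p v j l a b Op; rewrite !(form_linear _ v j l a b Op) //.
  rewrite !mulrDr !mulrA (mulrC k l) -!addrA; congr (_ + _).
  by rewrite addrCA.
- by move=> p v i j Op ij vij; rewrite !(form_alt _ Op ij vij) // mulr0 addr0.
Qed.

Lemma is_form0 r : is_form O (fun _ _ => 0 : R : Type) (r := r).
Proof.
split=> //.
- by move=> v; exact: smooth_on_cst.
- by move=> *; rewrite mulr0 addr0.
Qed.

(** The derivation of degree 0 that vanishes on functions and composes one-forms
    with A. *)
Definition ins (A : J -> J) r (w : form r) : form r :=
  fun p v => \sum_j w p (upd v j (A (v j))).

(** The Lie derivative of w along the linear vector field p |-> A p.  For A the
    shift of the jet coordinates in a direction, it is the total derivative. *)
Definition lie (A : J -> J) r (w : form r) : form r :=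
  fun p v => 'D_(A p) (fun q => w q v) p + ins A w p v.

Lemma is_form_ins A r (w : form r) : linear A -> is_form O w ->
  is_form O (ins A w).
Proof.
move=> lA fw; apply: is_formI.
- by move=> v; apply: smooth_on_sum => // j; exact: form_smooth.
- move=> p v j k a b Op; rewrite /ins.
  rewrite mulr_sumr -big_split /=; apply: eq_bigr => i _.
  have [->|ij] := eqVneq i j.
    by rewrite !upd_same !upd_upd lA (form_linear fw).
  by rewrite !upd_other // !(upd_comm v _ _ ij) (form_linear fw).
- move=> p v i j Op ij vij; rewrite /ins (bigD1 i) //= (bigD1 j) 1?eq_sym //=.
  rewrite big1 ?addr0; last first.
    move=> k /andP[ki kj]; apply: (form_alt fw Op ij).
    by rewrite !upd_other // eq_sym.
  rewrite -vij -{1}(upd_id (upd v i (A (v i))) j) upd_other 1?eq_sym // -vij.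
  rewrite (form_swap fw) // upd_id.
  by rewrite addNr.
Qed.

Lemma smooth_on_dir_derive (A : J -> J) (f : J -> R) : linear A ->
  smooth_on O f ->
  smooth_on O (fun p => 'D_(A p) f p).
Proof.
move=> lA fs.
apply: (@smooth_on_eq _ _ O (fun p => \sum_i \sum_j A p i j * 'D_(delta_mx i j)
  f p)) => //.
  by move=> p Op; rewrite -derive_basis //; exact: smooth_on_diff Op.
apply: smooth_on_sum => // i; apply: smooth_on_sum => // j.
apply: smooth_on_mul => //; last exact: smooth_on_derive.
by apply: smooth_on_linear => // k u v; rewrite lA !mxE.
Qed.

Lemma is_form_lie A r (w : form r) : linear A -> is_form O w ->
  is_form O (lie A w).
Proof.
move=> lA fw; have fi := is_form_ins lA fw; apply: is_formI.
- move=> v; apply: smooth_on_add => //; last exact: form_smooth.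
  by apply: smooth_on_dir_derive => //; exact: form_smooth.
- move=> p v j k a b Op; rewrite /lie.
  rewrite (form_linear fi) // mulrDr addrACA; congr (_ + _).
  rewrite (open_eq_derive _ oO (g :=
    fun q => k * w q (upd v j a) + w q (upd v j b))) //.
    have dv z : derivable (fun q => w q (upd v j z)) p (A p) by exact:
      form_derivable.
    rewrite deriveD //; last by apply: derivableZ.
    by rewrite deriveZ.
  by move=> q Oq; rewrite (form_linear fw).
- move=> p v i j Op ij vij; rewrite /lie (form_alt fi Op ij vij) addr0.
  by apply: derive_on0 => // q Oq; exact: form_alt Oq ij vij.
Qed.

Lemma is_form_extd r (w : form r) : is_form O w -> is_form O (extd w).
Proof.
move=> fw; apply: is_formI.
- move=> v; apply: smooth_on_sum => // i; apply: smooth_on_scale => //.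
  by apply: smooth_on_derive; exact: form_smooth.
- move=> p v j k a b Op; rewrite /extd.
  rewrite mulr_sumr -big_split /=; apply: eq_bigr => i _.
  rewrite mulrCA -mulrDr; congr (_ * _).
  case: (unliftP i j) => [j'|] ->; last first.
    by rewrite !upd_same !upd_lift_same derive_linear //; exact: form_diff.
  rewrite !upd_lift !(upd_other _ _ (neq_lift _ _)).
  set v' := fun k => v (lift i k).
  rewrite (open_eq_derive _ oO (g :=
    fun q => k * w q (upd v' j' a) + w q (upd v' j' b))) //.
    have dv z : derivable (fun q => w q (upd v' j' z)) p (v i) by exact:
      form_derivable.
    rewrite deriveD //; last by apply: derivableZ.
    by rewrite deriveZ.
  by move=> q Oq; rewrite (form_linear fw).
- case: r w fw => [|r] w fw p v a b Op ab vab; first by move: ab; rewrite !ord1.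
  rewrite /extd (bigD1 a) //= (bigD1 b) 1?eq_sym //= big1 ?addr0; last first.
    move=> i /andP[ia ib]; rewrite derive_on0 ?mulr0 // => q Oq.
    have [a' aE] : exists a', a = lift i a' by case: (unliftP i a) ia => [j|]
      ->; [exists j|rewrite eqxx].
    have [b' bE] : exists b', b = lift i b' by case: (unliftP i b) ib => [j|]
      ->; [exists j|rewrite eqxx].
    apply: (form_alt fw Oq (i := a') (j := b')); last by rewrite -aE -bE.
    by apply: contra ab => /eqP a'b'; rewrite aE bE a'b'.
  have [a' aE] : exists a', a = lift b a' by case: (unliftP b a) ab => [j|] ->;
    [exists j|rewrite eqxx].
  have [b' bE] : exists b', b = lift a b' by move: ab; rewrite eq_sym;
    case: (unliftP a b) => [j|] ->; [exists j|rewrite eqxx].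
  have [ll sgn] := lift_lift aE bE.
  have front (x y : 'I_r.+2) (y' : 'I_r.+1) : y = lift x y' ->
    'D_(v x) (fun q => w q (fun k => v (lift x k))) p =
      (-1) ^+ y' * 'D_(v x) (fun q => w q (fcons (v y) (fun k => v (lift x (lift
        y' k))))) p.
    move=> ->; set f := fun q => w q (fcons _ _).
    rewrite (open_eq_derive _ oO (g := fun q => (-1) ^+ y' * f q)) //.
      by rewrite deriveZ //; exact: form_derivable.
    move=> q Oq; rewrite /f (form_front (fun k => v (lift x k)) y' fw Oq).
    by rewrite mulrA -exprD addnn -signr_odd odd_double mul1r.
  rewrite (front a b b' bE) (front b a a' aE) vab !mulrA -!exprD.
  have -> : (fun k => v (lift a (lift b' k))) =
    (fun k => v (lift b (lift a' k))).
    by apply/funext => k; rewrite ll.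
  by rewrite -mulrDl -(signr_odd _ (a + b')) sgn -(signr_odd _ (b + a')) signrN
    addNr mul0r.
Qed.

End FormCalculus.

(** * Commutation of the operations on forms *)

Section FormIdentities.
Variables (R : realType) (m n L : nat).
Local Notation J := 'M[R]_(n, nmi m L).
Local Notation form r := (Defs.form R m n r L).
Variables (O : set J) (oO : open O).
Implicit Types (p q u x y : J) (A B : J -> J).

Lemma eq_ins A r (w w' : form r) : eq_form_on O w w' ->
  eq_form_on O (ins A w) (ins A w').
Proof. by move=> ww' p v Op; apply: eq_bigr => j _; exact: ww'. Qed.

Lemma eq_lie A r (w w' : form r) : eq_form_on O w w' ->
  eq_form_on O (lie A w) (lie A w').
Proof.
move=> ww' p v Op; rewrite /lie (eq_ins _ ww') //; congr (_ + _).
by apply: open_eq_derive Op => // q Oq; exact: ww'.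
Qed.

Lemma eq_extd r (w w' : form r) : eq_form_on O w w' ->
  eq_form_on O (extd w) (extd w').
Proof.
move=> ww' p v Op; apply: eq_bigr => i _; congr (_ * _).
by apply: open_eq_derive Op => // q Oq; exact: ww'.
Qed.

Lemma derive_form_sum r (w : form r) (I : Type) (s : seq I)
    (c : I -> R) (v : I -> 'I_r -> J) p u : is_form O w -> O p ->
  'D_u (fun q => \sum_(i <- s) c i * w q (v i)) p =
  \sum_(i <- s) c i * 'D_u (fun q => w q (v i)) p.
Proof.
move=> fw Op; elim: s => [|i s IH].
  by rewrite big_nil; apply: derive_on0 Op => // q _; rewrite big_nil.
rewrite big_cons -IH; have d j : derivable (fun q => c j * w q (v j)) p u.
  by apply: derivableZ; exact: form_derivable fw Op.
have Z : 'D_u (fun q => c i * w q (v i)) p = c i * 'D_u (fun q => w q (v i)) p.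
  by apply: deriveZ; exact: form_derivable fw Op.
rewrite -Z -deriveD //.
  by apply: open_eq_derive Op => // q _; rewrite big_cons.
apply: (@smooth_on_derivable _ _ O) Op; apply: smooth_on_sum => // j.
by apply: smooth_on_scale => //; exact: form_smooth.
Qed.

Lemma derive_ins A r (w : form r) p u v : is_form O w -> O p ->
  'D_u (fun q => ins A w q v) p = \sum_j 'D_u (fun q => w q (upd v j (A (v j))))
    p.
Proof.
move=> fw Op.
have := derive_form_sum (index_enum _) (fun=> 1) (fun j => upd v j (A (v j))) u
  fw Op.
under eq_bigr do rewrite mul1r; move=> <-.
apply: open_eq_derive Op => // q _; rewrite /ins.
by apply: eq_bigr => j _; rewrite mul1r.
Qed.

(** The field p |-> A p being linear, differentiating along it gives a term in
    A u besides the second derivative. *)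
Lemma derive_dir_derive A (f : J -> R) p u : linear A -> smooth_on O f -> O p ->
  'D_u (fun q => 'D_(A q) f q) p = 'D_(A u) f p + 'D_u ('D_(A p) f) p.
Proof.
move=> lA fs Op.
have lAij i j : linear (fun q => A q i j : R) by move=> k x y; rewrite lA !mxE.
have sd i j := smooth_on_derive (delta_mx i j) fs.
pose F (c : 'I_n -> 'I_(nmi m L) -> J -> R) q : R :=
  \sum_i \sum_j c i j q * 'D_(delta_mx i j) f q.
have FE (c : 'I_n -> 'I_(nmi m L) -> J -> R) dc :
    (forall i j, is_derive p u (c i j) (dc i j)) ->
    'D_u (F c) p = \sum_i \sum_j (dc i j * 'D_(delta_mx i j) f p +
        c i j p * 'D_u ('D_(delta_mx i j) f) p).
  move=> cD.
  have E : F c = \sum_i \sum_j (c i j * 'D_(delta_mx i j) f).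
    apply/funext => q; rewrite fct_sumE; apply: eq_bigr => i _.
    by rewrite fct_sumE.
  have dij i j : is_derive p u (c i j * 'D_(delta_mx i j) f)
      (dc i j * 'D_(delta_mx i j) f p + c i j p * 'D_u ('D_(delta_mx i j) f) p).
    have d1 : is_derive p u ('D_(delta_mx i j) f) ('D_u ('D_(delta_mx i j) f)
      p).
      by apply/derivableP; exact: smooth_on_derivable (sd i j) Op.
    have [d2 d2E] := is_deriveM (cD i j) d1.
    by split=> //; rewrite d2E addrC; congr (_ + _); exact: mulrC.
  by rewrite E; apply: derive_val.
have cst_D i j : is_derive p u (fun=> A p i j) 0 by exact: is_derive_cst.
have lin_D i j : is_derive p u (fun q => A q i j : R) (A u i j).
  split; first by apply: diff_derivable; exact: linear_mx_differentiable.
  exact: (linear_mx_derive p u (lAij i j)).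
rewrite (open_eq_derive u oO (g := F (fun i j q => A q i j))) //; last first.
  by move=> q Oq; rewrite derive_basis //; exact: smooth_on_diff Oq.
rewrite [in RHS](open_eq_derive u oO (f := 'D_(A p) f) (g :=
  F (fun i j _ => A p i j))) //; last first.
  by move=> q Oq; rewrite derive_basis //; exact: smooth_on_diff Oq.
rewrite (FE _ _ lin_D) (FE _ _ cst_D) derive_basis;
  last exact: smooth_on_diff Op.
rewrite -big_split /=; apply: eq_bigr => i _.
rewrite -big_split /=; apply: eq_bigr => j _.
by rewrite mul0r add0r.
Qed.

(* A acts on the argument i first; for i = j, B then acts on the result *)
Let upd2 A B r (v : 'I_r -> J) i j :=
  let v' := upd v i (A (v i)) in upd v' j (B (v' j)).

Let upd2C A B r (v : 'I_r -> J) i j : i != j -> upd2 A B v i j = upd2 B A v j i.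
Proof.
move=> ij; have ji : j != i by rewrite eq_sym.
by rewrite /upd2 (upd_other _ _ ji) (upd_other _ _ ij) upd_comm.
Qed.

Let upd2_diag A B r (v : 'I_r -> J) i : upd2 A B v i i = upd v i (B (A (v i))).
Proof. by rewrite /upd2 upd_same upd_upd. Qed.

(** The coefficients are differentiated in the same way by both composites, and
    two distinct arguments are modified independently: only the terms in which
    A and B meet in the same argument remain. *)
Lemma ins_lie A B r (w : form r) p v : linear A -> linear B -> is_form O w ->
  O p ->
  ins B (lie A w) p v - lie A (ins B w) p v =
  ins (fun x => A (B x) - B (A x)) w p v.
Proof.
move=> lA lB fw Op; rewrite /lie derive_ins // {1}/ins big_split /=.
rewrite opprD addrACA subrr add0r [X in _ - X]exchange_big /= -sumrB.
apply: eq_bigr => j _; rewrite -sumrB (bigD1 j) //= big1 ?addr0 => [|i ij].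
  have -> x y : w p (upd v j (x - y)) = w p (upd v j x) - w p (upd v j y).
    by rewrite addrC -scaleN1r (form_linear fw) // mulN1r addrC.
  by rewrite -!/(upd2 _ _ _ _ _) !upd2_diag.
by rewrite -!/(upd2 _ _ _ _ _) (upd2C A B) // subrr.
Qed.

Lemma lie_comm A B r (w : form r) p v : linear A -> linear B ->
  (forall x, A (B x) = B (A x)) -> is_form O w -> O p ->
  lie A (lie B w) p v = lie B (lie A w) p v.
Proof.
move=> lA lB AB fw Op.
have key A' B' : linear A' -> linear B' -> lie A' (lie B' w) p v =
    'D_(B' (A' p)) (fun q => w q v) p + 'D_(A' p) ('D_(B' p) (fun q => w q v)) p
    + (\sum_j 'D_(A' p) (fun q => w q (upd v j (B' (v j)))) p +
       \sum_j 'D_(B' p) (fun q => w q (upd v j (A' (v j)))) p)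
    + \sum_i \sum_j w p (upd2 A' B' v i j).
  move=> lA' lB'; have fs := form_smooth fw v.
  rewrite {1}/lie; rewrite /lie deriveD; first last.
  - by apply: form_derivable Op => //; exact: is_form_ins.
  - by apply: smooth_on_derivable Op; exact: smooth_on_dir_derive.
  rewrite derive_dir_derive // derive_ins // {1}/ins big_split /=.
  by rewrite !addrA.
rewrite !key // AB (schwarz _ _ oO Op (form_smooth fw v)).
congr (_ + _ + _); first by rewrite addrC.
rewrite exchange_big /=; apply: eq_bigr => i _; apply: eq_bigr => j _.
by have [->|ij] := eqVneq i j; [rewrite !upd2_diag AB|rewrite upd2C // eq_sym].
Qed.

(** The terms indexed by (i, i') and (i', i) cancel, by the symmetry of second
    derivatives and lift_lift. *)
Lemma extd_extd r (w : form r) p v : is_form O w -> O p ->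
  extd (extd w) p v = 0.
Proof.
move=> fw Op; rewrite /extd.
pose G (i i' : 'I_r.+2) : R := if unlift i i' is Some j then
  (-1) ^+ (i + j) * 'D_(v i) ('D_(v i') (fun q => w q (fun k => v (lift i (lift
    j k))))) p
  else 0.
have GE (i : 'I_r.+2) : (-1) ^+ i * 'D_(v i) (fun q => \sum_(j < r.+1) (-1) ^+ j
  *
    'D_(v (lift i j)) (fun q' => w q' (fun k => v (lift i (lift j k)))) q) p =
    \sum_i' G i i'.
  rewrite (bigD1_ord i) //= {1}/G unlift_none add0r.
  have -> : 'D_(v i) (fun q => \sum_(j < r.+1) (-1) ^+ j *
      'D_(v (lift i j)) (fun q' => w q' (fun k => v (lift i (lift j k)))) q) p =
    \sum_(j < r.+1) (-1) ^+ j * 'D_(v i) ('D_(v (lift i j))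
       (fun q' => w q' (fun k => v (lift i (lift j k))))) p.
    have dj (j : 'I_r.+1) : derivable ('D_(v (lift i j))
       (fun q' => w q' (fun k => v (lift i (lift j k))))) p (v i).
      by apply: smooth_on_derivable Op; apply: smooth_on_derive;
        exact: form_smooth.
    rewrite (_ : (fun q => _) = \sum_(j < r.+1) ((-1) ^+ j : R) *: 'D_(v (lift i
      j))
       (fun q' => w q' (fun k => v (lift i (lift j k))))); last first.
      by apply/funext => q; rewrite fct_sumE.
    rewrite derive_sum; last by move=> j; exact: derivableZ.
    by apply: eq_bigr => j _; rewrite deriveZ.
  rewrite mulr_sumr; apply: eq_bigr => j _.
  by rewrite /G liftK mulrA exprD.
under eq_bigr do rewrite GE.
have anti i i' : G i i' = - G i' i.
  have [->|ne] := eqVneq i i'; first by rewrite /G unlift_none oppr0.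
  have [a' aE] : exists a', i = lift i' a'.
    by case: (unliftP i' i) ne => [j|] ->; [exists j|rewrite eqxx].
  have [b' bE] : exists b', i' = lift i b'.
    by move: ne; rewrite eq_sym; case: (unliftP i i') => [j|] ->;
      [exists j|rewrite eqxx].
  have [ll sgn] := lift_lift aE bE.
  rewrite /G {1}bE liftK [in X in _ = - X]aE liftK.
  rewrite -aE (schwarz _ _ oO Op (form_smooth fw _)).
  have -> : (fun k => v (lift i (lift b' k))) =
    (fun k => v (lift i' (lift a' k))).
    by apply/funext => k; rewrite ll.
  by rewrite -(signr_odd _ (i + b')) sgn -(signr_odd _ (i' + a')) signrN !mulNr.
set S := LHS.
have : S = - S.
  rewrite {1}/S exchange_big /= -sumrN; apply: eq_bigr => i _.
  by rewrite -sumrN; apply: eq_bigr => i' _.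
by move=> /eqP; rewrite -addr_eq0 -mulr2n mulrn_eq0 /= => /eqP.
Qed.

(** The derivative along v i of the coefficient of the field A produces exactly
    the term in which A is applied to the argument v i. *)
Lemma extd_lie A r (w : form r) p v : linear A -> is_form O w -> O p ->
  extd (lie A w) p v = lie A (extd w) p v.
Proof.
move=> lA fw Op; pose vi i := fun k => v (lift i k).
have E1 i : 'D_(v i) (fun q => lie A w q (vi i)) p =
    'D_(A (v i)) (fun q => w q (vi i)) p +
    'D_(A p) ('D_(v i) (fun q => w q (vi i))) p +
    \sum_j 'D_(v i) (fun q => w q (upd (vi i) j (A (vi i j)))) p.
  rewrite /lie deriveD; first last.
  - by apply: form_derivable Op => //; exact: is_form_ins.
  - apply: smooth_on_derivable Op; apply: smooth_on_dir_derive => //.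
    exact: form_smooth.
  rewrite (@derive_dir_derive A (fun q => w q (vi i)) p (v i) lA (form_smooth fw
    _) Op).
  rewrite (@derive_ins A r w p (v i) (vi i) fw Op).
  by rewrite (schwarz (v i) (A p) oO Op (form_smooth fw (vi i))).
have E2 : 'D_(A p) (fun q => extd w q v) p =
    \sum_(i < r.+1) (-1) ^+ i * 'D_(A p) ('D_(v i) (fun q => w q (vi i))) p.
  have di (i : 'I_r.+1) : derivable ('D_(v i) (fun q => w q (vi i))) p (A p).
    by apply: smooth_on_derivable Op; apply: smooth_on_derive;
      exact: form_smooth.
  rewrite (_ : (fun q => _) = \sum_(i < r.+1) ((-1) ^+ i : R) *:
       'D_(v i) (fun q' => w q' (vi i))); last first.
    by apply/funext => q; rewrite fct_sumE.
  rewrite derive_sum; last by move=> i; exact: derivableZ.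
  by apply: eq_bigr => i _; rewrite deriveZ.
rewrite [RHS]/lie E2 /ins /extd exchange_big /= -big_split /=.
apply: eq_bigr => i _; rewrite -mulr_sumr -mulrDr -/(vi i) E1; congr (_ * _).
rewrite [in RHS](bigD1_ord i) //= upd_lift_same upd_same -/(vi i).
rewrite -[LHS]addrA [LHS]addrCA; congr (_ + (_ + _)); apply: eq_bigr => j _.
by rewrite upd_lift (upd_other _ _ (neq_lift _ _)).
Qed.

End FormIdentities.

(** * The Poincare lemma on a ball *)

Section Poincare.
Variables (R : realType) (m n L : nat).
Local Notation J := 'M[R]_(n, nmi m L).
Local Notation form r := (Defs.form R m n r L).
Variables (c : J) (e : R).
Local Notation O := (ball c e).
Let oO : open O := @open_ballc _ _ _ c e.
Implicit Types (p q x y : J).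

Lemma is_form_derive r (w : form r) x : is_form O w ->
  is_form O (fun p v => 'D_x (fun q => w q v) p).
Proof.
move=> fw; apply: is_formI.
- by move=> v; apply: smooth_on_derive; exact: form_smooth.
- move=> p v j k a b Op.
  rewrite (open_eq_derive _ oO (g :=
    fun q => k * w q (upd v j a) + w q (upd v j b))) //.
    have dv z : derivable (fun q => w q (upd v j z)) p x by exact:
      form_derivable fw Op.
    rewrite deriveD //; last by apply: derivableZ.
    by rewrite deriveZ.
  by move=> q Oq; rewrite (form_linear fw).
- move=> p v i j Op ij vij.
  by apply: (derive_on0 oO) Op => q Oq; exact: (form_alt fw Oq ij vij).
Qed.

(** Lets the first argument depend on the point without losing smoothness. *)
Lemma form_fcons_basis r (w : form r.+1) p x u : is_form O w -> O p ->
  w p (fcons x u) = \sum_i \sum_j x i j * w p (fcons (delta_mx i j) u).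
Proof.
move=> fw Op; have E z : fcons z u = upd (fcons 0 u) ord0 z.
  apply/funext => k; rewrite updE; case: (unliftP ord0 k) => [j|] ->.
    by rewrite !fconsS eq_sym (negPf (neq_lift _ _)).
  by rewrite fcons0 eqxx.
rewrite {1}[x]matrix_sum_delta E (form_sum fw) //; apply: eq_bigr => i _.
rewrite (form_sum fw) //; apply: eq_bigr => j _.
by rewrite (form_argZ fw) // -E.
Qed.

Lemma cone_fcons r (w : form r.+1) k p x u : is_form O w -> O p ->
  \sum_i \sum_j x i j * cone c k (fun q => w q (fcons (delta_mx i j) u)) p =
  cone c k (fun q => w q (fcons x u)) p.
Proof.
move=> fw Op.
have ws v : smooth_on O (fun q => w q v) := form_smooth fw v.
rewrite (@eq_cone _ _ _ c e k _ (fun q => \sum_i \sum_j x i j * w q (fcons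
  (delta_mx i j) u))) //.
  rewrite (@cone_sum _ _ _ c e) //; last first.
    by move=> i; apply: smooth_on_sum => // j; exact: smooth_on_scale.
  apply: eq_bigr => i _; rewrite (@cone_sum _ _ _ c e) //; last first.
    by move=> j; exact: smooth_on_scale.
  by apply: eq_bigr => j _; rewrite (@coneZ _ _ _ c e).
by move=> q Oq; exact: form_fcons_basis.
Qed.

(** The homotopy operator of the Poincare lemma for the contraction of the
    ball to its centre, with the vector p - c expanded in the standard basis
    so that its smoothness is visible. *)
Definition homotopy r (w : form r.+1) : form r := fun p u =>
  \sum_i \sum_j (p - c) i j * cone c r (fun q => w q (fcons (delta_mx i j) u))
    p.

Lemma homotopyE r (w : form r.+1) p u : is_form O w -> O p ->
  homotopy w p u = cone c r (fun q => w q (fcons (p - c) u)) p.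
Proof. by move=> fw Op; exact: cone_fcons. Qed.

Let coordc i j : linear (fun p : J => p i j : R).
Proof. by move=> k x y; rewrite !mxE. Qed.

Lemma smooth_on_homotopy r (w : form r.+1) u : is_form O w ->
  smooth_on O (fun p => homotopy w p u).
Proof.
move=> fw; apply: smooth_on_sum => // i; apply: smooth_on_sum => // j.
apply: smooth_on_mul => //; last first.
  by apply: smooth_on_cone; exact: form_smooth.
apply: (@smooth_on_eq _ _ O (fun p => p i j + (- c i j))) => //.
  by move=> p _; rewrite !mxE.
apply: smooth_on_add => //; last exact: smooth_on_cst.
by apply: smooth_on_linear => //; exact: coordc.
Qed.

Lemma is_form_homotopy r (w : form r.+1) : is_form O w ->
  is_form O (homotopy w).
Proof.
move=> fw; have ws v : smooth_on O (fun q => w q v) := form_smooth fw v.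
apply: is_formI; first by move=> v; exact: smooth_on_homotopy.
- move=> p v j k x y Op; rewrite !homotopyE // !fcons_upd.
  rewrite -(@coneZ _ _ _ c e) // -(@coneD _ _ _ c e) //;
    last exact: smooth_on_scale.
  by apply: (@eq_cone _ _ _ c e) => // q Oq; rewrite (form_linear fw).
- move=> p v i j Op ij vij; rewrite homotopyE //.
  rewrite -[RHS](mul0r (cone c r (fun q => w q (fcons (p - c) v)) p)).
  rewrite -(@coneZ _ _ _ c e) //; apply: (@eq_cone _ _ _ c e) => // q Oq.
  rewrite mul0r; apply: (form_alt fw Oq (i := lift ord0 i) (j := lift ord0 j)).
    by rewrite (inj_eq lift_inj).
  by rewrite !fconsS.
Qed.

Lemma derive_homotopy r (w : form r.+1) p x u : is_form O w -> O p ->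
  'D_x (fun q => homotopy w q u) p =
  cone c r (fun q => w q (fcons x u)) p +
  cone c r.+1 ('D_x (fun q => w q (fcons (p - c) u))) p.
Proof.
move=> fw Op; have ws v : smooth_on O (fun q => w q v) := form_smooth fw v.
rewrite -(cone_fcons r x u fw Op) -(cone_fcons r.+1 (p - c) u (is_form_derive x
  fw) Op).
pose f i j : J -> R := cone c r (fun q => w q (fcons (delta_mx i j) u)).
have E : (fun q => homotopy w q u) =
  \sum_i \sum_j ((fun q : J => (q - c) i j) * f i j).
  apply/funext => q; rewrite fct_sumE; apply: eq_bigr => i _.
  by rewrite fct_sumE.
have dij i j : is_derive p x ((fun q : J => (q - c) i j) * f i j)
   (x i j * f i j p + (p - c) i j * cone c r.+1 ('D_x (fun q => w q (fcons
     (delta_mx i j) u))) p).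
  have d1 : is_derive p x (fun q : J => (q - c) i j) (x i j).
    have -> : (fun q : J => (q - c) i j) = (fun q => q i j : R) - cst (c i j).
      by apply/funext => q; rewrite !mxE.
    have dl : derivable (fun q : J => q i j : R) p x.
      by apply: diff_derivable; apply: linear_mx_differentiable; exact: coordc.
    have := is_deriveB (derivableP dl) (is_derive_cst (c i j) p x).
    by rewrite subr0 (linear_mx_derive p x (coordc i j)).
  have [d2 D2] := @cone_diff _ _ _ c e r _ p (ws (fcons (delta_mx i j) u)) Op.
  have d2' : is_derive p x (f i j) (cone c r.+1 ('D_x (fun q => w q (fcons
    (delta_mx i j) u))) p).
    by split; [exact: diff_derivable|exact: D2].
  have [d3 d3E] := is_deriveM d1 d2'.
  by split=> //; rewrite d3E addrC; congr (_ + _); exact: mulrC.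
rewrite E derive_val -big_split /=; apply: eq_bigr => i _.
by rewrite -big_split.
Qed.

(** The integrand of the exterior derivative of the homotopy is, by closedness,
    the one evaluated in cone_euler. *)
Theorem poincare r (w : form r.+1) : is_form O w ->
  (forall p v, O p -> extd w p v = 0) ->
  forall p v, O p -> extd (homotopy w) p v = w p v.
Proof.
move=> fw clw p v Op; have ws u : smooth_on O (fun q => w q u) :=
  form_smooth fw u.
pose vi k := fun l => v (lift k l).
rewrite /extd; under eq_bigr => k _ do
  rewrite (@derive_homotopy r w p (v k) (vi k)) // mulrDr.
rewrite big_split /= -[RHS](@cone_euler _ _ _ c e r (fun q => w q v)) //.
congr (_ + _).
  rewrite (eq_bigr (fun=> cone c r (fun q => w q v) p)) => [|k _].
    by rewrite sumr_const card_ord mulr_natl.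
  rewrite -(@coneZ _ _ _ c e) //; apply: (@eq_cone _ _ _ c e) => // q Oq.
  by rewrite (form_front v k fw Oq) mulrA -exprD addnn -signr_odd odd_double
    mul1r.
have sD k : smooth_on O ('D_(v k) (fun q => w q (fcons (p - c) (vi k)))).
  exact: smooth_on_derive.
have -> : \sum_(k < r.+1) (-1) ^+ k * cone c r.+1 ('D_(v k) (fun q => w q (fcons
  (p - c) (vi k)))) p
  = cone c r.+1 (fun q => \sum_(k < r.+1) (-1) ^+ k * 'D_(v k) (fun q' => w q'
    (fcons (p - c) (vi k))) q) p.
  rewrite (@cone_sum _ _ _ c e) //; last by move=> k; exact: smooth_on_scale.
  by apply: eq_bigr => k _; rewrite (@coneZ _ _ _ c e).
apply: (@eq_cone _ _ _ c e) => // q Oq.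
have := clw q (fcons (p - c) v) Oq; rewrite /extd big_ord_recl /= expr0 mul1r.
move=> /eqP; rewrite addr_eq0 => /eqP; rewrite fcons0.
have -> : (fun k => fcons (p - c) v (lift ord0 k)) = v.
  by apply/funext => k; rewrite fconsS.
move=> ->; rewrite -sumrN; apply: eq_bigr => k _.
rewrite fconsS (fcons_lift (p - c) v k) /= /bump /= add1n exprS mulN1r mulNr
  opprK.
by [].
Qed.

End Poincare.

(** * Koszul complexes over a Weyl algebra *)

Section Signs.
Variables (R : realFieldType) (m : nat).
Implicit Types (S : {set 'I_m}) (i j : 'I_m).

Definition sgn S i : R := (-1) ^+ #|[set j in S | (j < i)%N]|.

Lemma sgn_sq S i : sgn S i * sgn S i = 1.
Proof. by rewrite /sgn -exprD addnn -signr_odd odd_double. Qed.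

Lemma sgn_rem S i j : j \in S -> sgn S i =
  (-1) ^+ (j < i)%N * sgn (S :\ j)%SET i.
Proof.
move=> jS; rewrite /sgn -exprD; congr (_ ^+ _).
rewrite (cardsD1 j) !inE jS /=; congr (_ + _)%N.
by congr #|pred_of_set _|; apply/setP => k; rewrite !inE andbA.
Qed.

Lemma sgn_rem_same S i : i \in S -> sgn (S :\ i)%SET i = sgn S i.
Proof. by move=> iS; rewrite (sgn_rem i iS) ltnn expr0 mul1r. Qed.

Lemma sgn_swap S i j : i \in S -> j \in S -> i != j ->
  sgn S i * sgn (S :\ i)%SET j = - (sgn S j * sgn (S :\ j)%SET i).
Proof.
move=> iS jS ij; rewrite (sgn_rem i jS) (sgn_rem j iS).
have : (j < i)%N = ~~ (i < j)%N.
  by move: ij; rewrite -val_eqE /=; lia.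
move=> ->; case: (i < j)%N => /=;
  rewrite ?expr0 ?expr1 ?mul1r ?mulN1r ?mulNr ?opprK;
  by rewrite mulrC.
Qed.

End Signs.

(** The operators X i commute, and the operators a i satisfy with them the
    relations [a i, X j] = r delta_ij of a Weyl algebra and are nilpotent on
    each F k.  Such a module looks like polynomials in the X i with coefficients
    in the common kernel of the a i, hence the Koszul complex of the X i is
    exact below the top degree.  The relations are only required below the
    level L of the filtration, which the X i raise. *)
Section Koszul.
Variables (R : realFieldType) (M : lmodType R) (m r L : nat).
Variables (X a : 'I_m -> {linear M -> M}) (F : nat -> M -> Prop).
Implicit Types (S : {set 'I_m}) (i j : 'I_m) (x y : M) (w : {set 'I_m} -> M).

Hypothesis r_gt0 : (0 < r)%N.
Hypothesis F0 : forall k, F k 0.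
Hypothesis FD : forall k x y, F k x -> F k y -> F k (x + y).
Hypothesis FZ : forall k c x, F k x -> F k (c *: x).
Hypothesis Fmono : forall k l x, (k <= l)%N -> F k x -> F l x.
Hypothesis FX : forall k i x, F k x -> F k.+1 (X i x).
Hypothesis Fa : forall k i x, F k x -> F k (a i x).
Hypothesis XX : forall i j x, X i (X j x) = X j (X i x).
Hypothesis aX : forall k i j x, (k < L)%N -> F k x ->
  a i (X j x) = X j (a i x) + (if i == j then r%:R *: x else 0).
Hypothesis a_nil : forall k i x, F k x -> iter (r * k).+1 (a i) x = 0.

(** The sign of dt^i /\ dt^(S \ i) is the one used in the total exterior
    derivative, so that the latter is this operator with X i for the total
    derivatives. *)
Definition koszul w S : M := \sum_(i in S) sgn R S i *: X i (w (S :\ i)%SET).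

Lemma koszulB w w' S : koszul (fun T => w T - w' T) S =
  koszul w S - koszul w' S.
Proof. by rewrite /koszul -sumrB; apply: eq_bigr => i _;
  rewrite linearB scalerBr. Qed.

Lemma koszul_koszul w S : koszul (koszul w) S = 0.
Proof.
pose G i j := if [&& i \in S, j \in S & i != j] then
  (sgn R S i * sgn R (S :\ i)%SET j) *: X i (X j (w (S :\ i :\ j)%SET)) else 0.
have -> : koszul (koszul w) S = \sum_i \sum_j G i j.
  rewrite /koszul big_mkcond; apply: eq_bigr => i _; case: ifP => iS;
    last first.
    by rewrite big1 // => j _; rewrite /G iS.
  rewrite linear_sum scaler_sumr big_mkcond; apply: eq_bigr => j _.
  rewrite /G iS /= in_setD1 eq_sym andbC; case: ifP => // _.
  by rewrite linearZ scalerA.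
have anti i j : G i j = - G j i.
  rewrite /G eq_sym; case: (boolP (i \in S)) => iS;
    case: (boolP (j \in S)) => jS;
    rewrite /= ?oppr0 //.
  case: ifP => ji; rewrite ?oppr0 //.
  by rewrite sgn_swap 1?eq_sym // scaleNr XX !finset.setDDl finset.setUC.
set s := LHS; have : s = - s.
  rewrite {1}/s exchange_big /= -sumrN; apply: eq_bigr => i _.
  by rewrite -sumrN; apply: eq_bigr => j _.
by move=> /eqP; rewrite -addr_eq0 -mulr2n -scaler_nat scaler_eq0 pnatr_eq0 =>
  /eqP.
Qed.

Lemma iter_linear (f : {linear M -> M}) k c x y :
  iter k f (c *: x + y) = c *: iter k f x + iter k f y.
Proof. by elim: k => //= k ->; rewrite linearP. Qed.

Lemma F_iterX k i (j : nat) x : F k x -> F (k + j) (iter j (X i) x).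
Proof.
move=> Fx; elim: j => [|j IH]; first by rewrite addn0.
by rewrite addnS; exact: FX.
Qed.

Lemma F_itera k i (j : nat) x : F k x -> F k (iter j (a i) x).
Proof. by move=> Fx; elim: j => //= j; exact: Fa. Qed.

Lemma itera_X k i (j : nat) x : (k < L)%N -> F k x ->
  iter j (a i) (X i x) = X i (iter j (a i) x) + (j * r)%:R *: iter j.-1 (a i) x.
Proof.
move=> kL Fx; elim: j => [|j IH] /=; first by rewrite mul0n scale0r addr0.
rewrite IH linearD linearZ /= (aX _ _ kL (F_itera _ _ Fx)) eqxx -addrA.
congr (_ + _); case: j {IH} => [|j] /=;
  first by rewrite mul0n mul1n scale0r addr0.
by rewrite -scalerDl -natrD mulSn.
Qed.

Lemma itera_Xneq k i l (j : nat) x : (k < L)%N -> F k x -> i != l ->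
  iter j (a i) (X l x) = X l (iter j (a i) x).
Proof.
move=> kL Fx il; elim: j => //= j ->.
by rewrite (aX _ _ kL (F_itera _ _ Fx)) (negPf il) addr0.
Qed.

Lemma iterX_comm i l (j : nat) x : iter j (X i) (X l x) = X l (iter j (X i) x).
Proof. by elim: j => //= j ->; rewrite XX. Qed.

(** In the model where X i multiplies polynomials by the i-th variable and a i
    is r times the i-th partial derivative, this is the division with
    remainder by the i-th variable: p |-> (p - p(x_i = 0)) / x_i. *)
Definition quot i N x : M := \sum_(j < N)
  ((-1) ^+ j / ((j.+1)`!%:R * r%:R ^+ j.+1)) *: iter j (X i) (iter j.+1 (a i)
    x).

Lemma quot_linear i N : linear (quot i N).
Proof.
move=> c x y; rewrite /quot scaler_sumr -big_split /=; apply: eq_bigr => j _.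
by rewrite -!iterS (iter_linear (a i) j.+1) (iter_linear (X i)) scalerDr
  !scalerA (mulrC c).
Qed.

HB.instance Definition _ i N := GRing.isLinear.Build R M M *:%R (quot i N)
  (quot_linear i N).

Lemma F_sum k (I : Type) (s : seq I) (P : pred I) (f : I -> M) :
  (forall b, P b -> F k (f b)) -> F k (\sum_(b <- s | P b) f b).
Proof. by move=> Ff; apply: big_ind => // x y; exact: FD. Qed.

Lemma F_quot k i N x : F k x -> F (k + N) (quot i N x).
Proof.
move=> Fx; apply: F_sum => j _; apply/FZ/(@Fmono (k + j)).
  by rewrite leq_add2l ltnW.
by apply: F_iterX; exact: (@F_itera _ _ j.+1).
Qed.

(** The error term contains a power of a i; it disappears when that power kills
    x, and quot then divides by X i exactly. *)
Lemma quot_X k i N x : (k < L)%N -> F k x -> quot i N (X i x) =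
  x - ((-1) ^+ N / (N`!%:R * r%:R ^+ N)) *: iter N (X i) (iter N (a i) x).
Proof.
move=> kL Fx; elim: N => [|N IH].
  by rewrite /quot big_ord0 /= fact0 expr0 mulr1 divr1 scale1r subrr.
have r0 : r%:R != 0 :> R by rewrite pnatr_eq0 -lt0n.
have f0 k' : k'`!%:R != 0 :> R by rewrite pnatr_eq0 -lt0n fact_gt0.
rewrite /quot big_ord_recr /= -/(quot i N (X i x)) IH -addrA; congr (_ + _).
rewrite -!iterS (itera_X i N.+1 kL Fx) /=.
have -> u v c : iter N (X i) (u + c *: v) =
  iter N (X i) u + c *: iter N (X i) v.
  by rewrite addrC iter_linear addrC.
rewrite iterX_comm scalerDr scalerA.
set c1 := (-1) ^+ N / (N.+1`!%:R * r%:R ^+ N.+1).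
have -> : c1 * (N.+1 * r)%:R = (-1) ^+ N / (N`!%:R * r%:R ^+ N).
  rewrite /c1 factS !natrM !exprS; field.
  rewrite ?f0 ?r0 ?expf_neq0 //=.
rewrite exprS mulN1r mulNr -/c1 scaleNr opprK addrC addrK.
by [].
Qed.

Lemma quot_Xneq k i l N x : (k < L)%N -> F k x -> i != l ->
  quot i N (X l x) = X l (quot i N x).
Proof.
move=> kL Fx il; rewrite /quot linear_sum; apply: eq_bigr => j _.
rewrite (itera_Xneq j.+1 kL Fx il) //.
by rewrite linearZ iterX_comm.
Qed.

(** The homotopy for one index i: contraction with the i-th basis vector followed
    by the division by X i. *)
Definition contraction i N w S : M :=
  if i \in S then 0 else sgn R S i *: quot i N (w (i |: S)%SET).

(** The level reached from k when one index is eliminated: one unit for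
    subtracting a coboundary, and (r * (k + 1)) + 1 for the division, whose
    number of terms is the exponent of nilpotency at level k + 1. *)
Definition koszul_step k := (k.+1 + (r * k.+1).+1)%N.
Local Notation step := koszul_step.

(** Closedness at i |: S expresses the contribution of the other indices by
    X i (w S), from which the division recovers w S. *)
Lemma koszul_contraction_notin k i w S : (k < L)%N -> (forall S, F k (w S)) ->
  (forall S, koszul w S = 0) -> i \notin S ->
  koszul (contraction i (r * k).+1 w) S = w S.
Proof.
move=> kL Fw cw iS; set N := (r * k).+1.
have cS := cw (i |: S)%SET.
rewrite /koszul (big_setD1 i) ?setU11 //= setU1K // in cS.
have E : koszul (contraction i N w) S = quot i N (- sgn R (i |: S)%SET i *:
   \sum_(j in S) sgn R (i |: S)%SET j *: X j (w ((i |: S) :\ j)%SET)).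
  rewrite /koszul scaler_sumr linear_sum; apply: eq_bigr => j jS.
  have ij : i != j by apply: contraNneq iS => ->.
  rewrite /contraction in_setD1 (negPf iS) andbF.
  have SE : (i |: S :\ j = (i |: S) :\ j)%SET.
    by apply/setP => z; rewrite !inE; case: eqP => // ->; rewrite ij.
  rewrite SE !linearZ /= (quot_Xneq _ kL (Fw _) ij) !scalerA; congr (_ *: _).
  have iS' : i \in (i |: S)%SET by rewrite setU11.
  have jS' : j \in (i |: S)%SET by rewrite setU1r.
  have := sgn_swap R iS' jS' ij; rewrite setU1K // -SE.
  have -> : sgn R (i |: S :\ j)%SET i = sgn R (S :\ j)%SET i.
    have h : i \in (i |: S :\ j)%SET by rewrite setU11.
    by rewrite -(sgn_rem_same R h) setU1K // in_setD1 (negPf iS) andbF.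
  have := sgn_sq R S j; have := sgn_sq R (i |: S)%SET j.
  move: (sgn R _ _) (sgn R _ _) (sgn R _ _) (sgn R _ _) => s1 s2 s3 s4.
  move=> h3 h4 h; have h' : s4 * s1 = - (s2 * s3) by rewrite h opprK.
  rewrite -[s1]mul1r -h3 -(mulrA s4) h' mulrN mulNr -!mulrA h4 mulr1 mulNr.
  by rewrite mulrC.
rewrite E; move/eqP: cS; rewrite addrC addr_eq0 => /eqP ->.
rewrite scalerN scalerA mulNr scaleNr opprK sgn_sq scale1r.
rewrite (quot_X _ _ kL (Fw _)) (a_nil _ (Fw _)).
have -> : iter N (X i) 0 = 0 by elim: (N) => //= N' ->; rewrite linear0.
by rewrite scaler0 subr0.
Qed.

(** Only the index i contributes; in particular the homotopy for i does not
    spoil a component that vanishes already. *)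
Lemma koszul_contraction_in i N w S : i \in S ->
  koszul (contraction i N w) S = X i (quot i N (w S)).
Proof.
move=> iS; rewrite /koszul (big_setD1 i) //= big1 ?addr0 => [|j].
  rewrite /contraction in_setD1 eqxx /= finset.setD1K // sgn_rem_same //.
  by rewrite linearZ scalerA sgn_sq scale1r.
by rewrite in_setD1 /contraction => /andP[ji jS];
  rewrite in_setD1 eq_sym ji iS linear0 scaler0.
Qed.

Lemma F_contraction k i N w S : (forall S, F k (w S)) ->
  F (k + N) (contraction i N w S).
Proof. by move=> Fw; rewrite /contraction; case: ifP => // _;
  apply/FZ/F_quot. Qed.

Lemma F_koszul k w S : (forall S, F k (w S)) -> F k.+1 (koszul w S).
Proof. by move=> Fw; apply: F_sum => i _; apply/FZ/FX. Qed.

Lemma step_ge k : (k <= step k)%N.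
Proof. by rewrite /koszul_step addSnnS leq_addr. Qed.

Lemma iter_step_ge k N : (k <= iter N step k)%N.
Proof. by elim: N => //= N IH; exact: leq_trans IH (step_ge _). Qed.

(** The indices of l are eliminated one at a time; a component that has become
    zero for lack of an index stays zero in the later steps. *)
Lemma koszul_eliminate l k s w : (iter (size l) step k < L)%N ->
  (forall S, F k (w S)) -> (forall S, #|S| != s -> w S = 0) ->
  (forall S, koszul w S = 0) ->
  exists y : {set 'I_m} -> M,
    [/\ forall S, F (iter (size l) step k) (y S),
        forall S, #|S|.+1 != s -> y S = 0
      & forall S, ~~ (l \subset S) -> w S = koszul y S].
Proof.
move=> + Fw sw cw; elim: l => [|i l IH] lL.
  exists (fun=> 0); split=> [S|S|S] //.
  by move=> /negP[]; apply/fintype.subsetP.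
set k' := iter (size l) step k.
have k'L : (k' < L)%N by apply: leq_ltn_trans lL; exact: step_ge.
have [y [Fy sy wy]] := IH k'L.
have k'L' : (k'.+1 < L)%N.
  by apply: leq_ltn_trans lL; rewrite /= /koszul_step leq_addr.
pose w' S := w S - koszul y S.
have Fw' S : F k'.+1 (w' S).
  apply: FD; first by apply: Fmono (Fw S); rewrite leqW // iter_step_ge.
  by rewrite -scaleN1r; apply: FZ; exact: F_koszul.
have cw' S : koszul w' S = 0 by rewrite koszulB cw koszul_koszul subrr.
set N := (r * k'.+1).+1.
exists (fun S => y S + contraction i N w' S); split.
- move=> S; apply: FD; last exact: F_contraction.
  by apply: Fmono (Fy S); exact: step_ge.
- move=> S Ss; rewrite sy // add0r /contraction; case: ifP => // /negbT iS.
  rewrite /w' sw ?cardsU1 ?iS // sub0r.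
  rewrite /koszul big1 ?oppr0 ?linear0 ?scaler0 // => j jS.
  rewrite sy ?linear0 ?scaler0 //.
  by have := cardsD1 j (i |: S)%SET; rewrite jS cardsU1 iS !add1n => -[<-].
- move=> S lS; have -> : koszul (fun S => y S + contraction i N w' S) S =
      koszul y S + koszul (contraction i N w') S.
    rewrite /koszul -big_split; apply: eq_bigr => j _.
    by rewrite linearD scalerDr.
  apply/eqP; rewrite addrC -subr_eq -/(w' S); apply/eqP.
  case: (boolP (i \in S)) => iS; last by rewrite koszul_contraction_notin.
  have lS' : ~~ (l \subset S).
    apply: contra lS => /fintype.subsetP lS; apply/fintype.subsetP => z.
    by rewrite inE => /orP[/eqP ->|/lS].
  by rewrite koszul_contraction_in // /w' (wy _ lS') subrr !linear0.
Qed.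

(** Once all indices are eliminated, only the component at the full set can
    survive, and it is zero for a cocycle of degree s < m. *)
Theorem koszul_exact k s w : (s < m)%N -> (iter m step k < L)%N ->
  (forall S, F k (w S)) -> (forall S, #|S| != s -> w S = 0) ->
  (forall S, koszul w S = 0) ->
  exists y : {set 'I_m} -> M,
    [/\ forall S, F (iter m step k) (y S),
        forall S, #|S|.+1 != s -> y S = 0
      & forall S, w S = koszul y S].
Proof.
move=> sm mL Fw sw cw; have := @koszul_eliminate (enum 'I_m) k s w.
rewrite size_enum_ord => /(_ mL Fw sw cw) [y [Fy sy wy]]; exists y;
  split=> // S.
case: (boolP (enum 'I_m \subset S)) => [/fintype.subsetP ST|]; last exact: wy.
have {ST} -> : S = [set: 'I_m]%SET by apply/setP => i;
  rewrite inE ST // mem_enum.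
rewrite sw ?cardsT ?card_ord ?gtn_eqF //; apply/esym/big1 => i _.
rewrite sy ?linear0 ?scaler0 //.
have := cardsD1 i [set: 'I_m]%SET; rewrite inE cardsT card_ord add1n => <-.
by rewrite gtn_eqF.
Qed.

End Koszul.

(** * Multi-indices and jet spaces *)

Section MultiIndices.
Variable m : nat.
Local Notation idx := {ffun 'I_m -> nat}.
Implicit Types (I : idx) (i : 'I_m).

Definition weight I : nat := \sum_i I i.

Lemma weight_mi k (j : 'I_(nmi m k)) : (weight (mi j) <= k)%N.
Proof.
rewrite /weight (eq_bigr (fun i => nat_of_ord (val (enum_val j) i))).
  exact: (valP (enum_val j)).
by move=> i _; rewrite ffunE.
Qed.

Lemma mi_inj k : injective (@mi m k).
Proof.
move=> j j' E; apply: enum_val_inj; apply: val_inj; apply/ffunP => i.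
by apply: val_inj; have := congr1 (fun I : idx => I i) E; rewrite !ffunE.
Qed.

(** The entries of a multi-index of weight at most k fit in 'I_k.+1. *)
Lemma mi_surj k I : (weight I <= k)%N -> exists j : 'I_(nmi m k), mi j = I.
Proof.
move=> Ik; have Ii i : (I i < k.+1)%N.
  by rewrite ltnS (leq_trans _ Ik) // /weight (bigD1 i) //= leq_addr.
have P : (\sum_i [ffun i => Ordinal (Ii i)] i <= k)%N.
  by rewrite (eq_bigr I) // => i _; rewrite ffunE.
exists (enum_rank (exist _ [ffun i => Ordinal (Ii i)] P : mindex m k)).
by apply/ffunP => i; rewrite !ffunE enum_rankK /= ffunE.
Qed.

Definition mi_sub1 I i : idx := [ffun i' => (I i' - (i' == i))%N].

Lemma weight_add1 I i : weight (mi_add1 I i) = (weight I).+1.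
Proof.
rewrite /weight (eq_bigr (fun i' => I i' + (i' == i))%N).
  rewrite big_split /= -addn1; congr (_ + _)%N.
  by rewrite (bigD1 i) //= eqxx big1 // => i' /negPf ->.
by move=> i' _; rewrite ffunE.
Qed.

Lemma mi_add1K I i : mi_sub1 (mi_add1 I i) i = I.
Proof. by apply/ffunP => i'; rewrite !ffunE addnK. Qed.

Lemma mi_sub1K I i : (0 < I i)%N -> mi_add1 (mi_sub1 I i) i = I.
Proof.
move=> Ii; apply/ffunP => i'; rewrite !ffunE; case: eqP => [->|_].
  by rewrite subnK.
by rewrite subn0 addn0.
Qed.

Lemma weight_sub1 I i : (0 < I i)%N -> (weight (mi_sub1 I i)).+1 = weight I.
Proof. by move=> Ii; rewrite -(weight_add1 _ i) mi_sub1K. Qed.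

Lemma mi_add1C I i i' : mi_add1 (mi_add1 I i) i' = mi_add1 (mi_add1 I i') i.
Proof. by apply/ffunP => l; rewrite !ffunE addnAC. Qed.

Lemma mi_sub1_add1 I i i' : i != i' ->
  mi_sub1 (mi_add1 I i) i' = mi_add1 (mi_sub1 I i') i.
Proof.
move=> ne; apply/ffunP => l; rewrite !ffunE.
by case: (eqVneq l i') => [->|]; rewrite ?subn0 // eq_sym (negPf ne) !addn0.
Qed.

End MultiIndices.

Section JetSpaces.
Variables (R : realType) (m n : nat).
Local Notation J k := 'M[R]_(n, nmi m k).
Local Notation idx := {ffun 'I_m -> nat}.
Implicit Types (I : idx) (i : 'I_m) (a : 'I_n) (k l : nat).

Lemma ucoord_linear k a I : linear (fun x : J k => ucoord x a I).
Proof.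
move=> c x y; rewrite /ucoord scaler_sumr -big_split; apply: eq_bigr => j _.
by rewrite !mxE.
Qed.

Lemma ucoord_mi k (x : J k) a j : ucoord x a (mi j) = x a j.
Proof.
rewrite /ucoord (big_pred1 j) // => j'.
by rewrite /= (inj_eq (@mi_inj _ _)).
Qed.

Lemma ucoord_high k (x : J k) a I : (k < weight I)%N -> ucoord x a I = 0.
Proof.
move=> kI; rewrite /ucoord big_pred0 // => j; apply: contraTF kI => /eqP <-.
by rewrite -leqNgt weight_mi.
Qed.

(** Points of the jet space are given by functions of all multi-indices, those
    of weight greater than k being ignored; all the maps between jet spaces
    have this form. *)
Lemma ucoord_mx k (f : 'I_n -> idx -> R) a I :
  ucoord (\matrix_(a, j) f a (mi j) : J k) a I =
  if (weight I <= k)%N then f a I else 0.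
Proof.
case: leqP => Ik; last exact: ucoord_high.
by have [j <-] := mi_surj Ik; rewrite ucoord_mi mxE.
Qed.

Lemma ucoord_inj k (x y : J k) : (forall a I, ucoord x a I = ucoord y a I) ->
  x = y.
Proof. by move=> xy; apply/matrixP => a j; rewrite -!ucoord_mi. Qed.

Lemma ucoord_jproj k l (x : J l) a I : ucoord (jproj k x) a I =
  if (weight I <= k)%N then ucoord x a I else 0.
Proof. exact: ucoord_mx. Qed.

Lemma ucoord_jshift k l i (x : J l) a I : ucoord (jshift k i x) a I =
  if (weight I <= k)%N then ucoord x a (mi_add1 I i) else 0.
Proof. exact: (ucoord_mx k (fun a I => ucoord x a (mi_add1 I i))). Qed.

Lemma jproj_linear k l : linear (@jproj R m n l k : J l -> J k).
Proof. by move=> c x y; apply/matrixP => a j; rewrite !mxE ucoord_linear. Qed.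

Lemma jshift_linear k l i : linear (@jshift R m n l k i : J l -> J k).
Proof. by move=> c x y; apply/matrixP => a j; rewrite !mxE ucoord_linear. Qed.

HB.instance Definition _ k i :=
  GRing.isLinear.Build R (J k) (J k) *:%R (@jshift R m n k k i) (@jshift_linear
    k k i).

(** The transpose of du^a_I |-> I(i) du^a_(I - 1_i), the vertical endomorphism
    of the jet space attached to the i-th coordinate. *)
Definition vlower k i (x : J k) : J k :=
  \matrix_(a, j) ((mi j i)%:R * ucoord x a (mi_sub1 (mi j) i)).

Lemma ucoord_vlower k i (x : J k) a I : ucoord (vlower i x) a I =
  if (weight I <= k)%N then (I i)%:R * ucoord x a (mi_sub1 I i) else 0.
Proof. exact: (ucoord_mx k (fun a I => (I i)%:R * ucoord x a (mi_sub1 I i))).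
  Qed.

Lemma vlower_linear k i : linear (@vlower k i).
Proof.
move=> c x y; apply/matrixP => a j; rewrite !mxE ucoord_linear mulrDr.
by rewrite mulrCA.
Qed.

HB.instance Definition _ k i :=
  GRing.isLinear.Build R (J k) (J k) *:%R (@vlower k i) (@vlower_linear k i).

(** The vectors killed by the projection to the jets of order less than d. *)
Definition vanish k d (x : J k) : Prop :=
  forall a I, (weight I < d)%N -> ucoord x a I = 0.

Lemma vanish_le k d d' (x : J k) : (d' <= d)%N -> vanish d x -> vanish d' x.
Proof. by move=> dd' vx a I Id; apply: vx; exact: leq_trans dd'. Qed.

Lemma vanish_eq0 k d (x : J k) : (k < d)%N -> vanish d x -> x = 0.
Proof.
move=> kd vx; apply: ucoord_inj => a I.
have z : ucoord (0 : J k) a I = 0.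
  by rewrite /ucoord big1 // => j _; rewrite mxE.
rewrite z; case: (leqP (weight I) k) => Ik; last exact: ucoord_high.
by apply: vx; exact: leq_ltn_trans kd.
Qed.

Lemma vanish_jshift k d i (x : J k) : vanish d.+1 x -> vanish d (jshift k i x).
Proof.
move=> vx a I Id; rewrite ucoord_jshift; case: ifP => // _.
by apply: vx; rewrite weight_add1.
Qed.

Lemma vanish_vlower k d i (x : J k) : vanish d x -> vanish d.+1 (vlower i x).
Proof.
move=> vx a I Id; rewrite ucoord_vlower; case: ifP => // _.
case: (posnP (I i)) => Ii; first by rewrite Ii mul0r.
by rewrite vx ?mulr0 // -ltnS weight_sub1.
Qed.

Lemma jshift_comm k i i' (x : J k) :
  jshift k i (jshift k i' x) = jshift k i' (jshift k i x).
Proof.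
apply: ucoord_inj => a I; rewrite !ucoord_jshift !weight_add1 mi_add1C.
by [].
Qed.

(** The canonical commutation relation of total derivatives and vertical
    endomorphisms; the truncation spoils it in the top order only. *)
Lemma jshift_vlower k i i' (x : J k) : vanish k
  (jshift k i (vlower i' x) - vlower i' (jshift k i x)
   - (if i' == i then x else 0)).
Proof.
move=> a I Ik.
have ucB (y z : J k) : ucoord (y - z) a I = ucoord y a I - ucoord z a I.
  by rewrite addrC -scaleN1r ucoord_linear scaleN1r addrC.
rewrite !ucB ucoord_jshift !ucoord_vlower ucoord_jshift (ltnW Ik) weight_add1
  Ik.
have z : ucoord (0 : J k) a I = 0.
  by rewrite /ucoord big1 // => j _; rewrite mxE.
have le1 : (weight (mi_sub1 I i') <= k)%N.
  by rewrite (leq_trans _ (ltnW Ik)) // leq_sum // => l _;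
    rewrite ffunE leq_subr.
rewrite le1 ffunE; case: eqVneq => [->|ne].
  rewrite mi_add1K; case: (posnP (I i)) => Ii.
    by rewrite Ii add0n mul1r mul0r subr0 subrr.
  by rewrite mi_sub1K // addn1 -natr1; ring.
by rewrite z subr0 addn0 mi_sub1_add1 1?eq_sym // subrr.
Qed.

Lemma jproj_jproj k l l' (x : J l') : (k <= l)%N ->
  jproj k (jproj l x) = jproj k x.
Proof.
move=> kl; apply: ucoord_inj => a I; rewrite !ucoord_jproj; case: leqP => // Ik.
by rewrite (leq_trans Ik kl).
Qed.

Lemma jproj_jshift k l l' i (x : J l') : (k <= l)%N ->
  jproj k (jshift l i x) = jshift k i x.
Proof.
move=> kl; apply: ucoord_inj => a I; rewrite ucoord_jproj !ucoord_jshift.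
by case: leqP => // Ik; rewrite (leq_trans Ik kl).
Qed.

Lemma jshift_jproj k l l' i (x : J l') : (k < l)%N ->
  jshift k i (jproj l x) = jshift k i x.
Proof.
move=> kl; apply: ucoord_inj => a I;
  rewrite !ucoord_jshift ucoord_jproj weight_add1.
by case: (leqP (weight I) k) => // Ik; rewrite (leq_ltn_trans Ik kl).
Qed.

(** Shifting jets of order k + 1 and shifting their truncations differ only in
    the coordinates of order k. *)
Lemma jshift_trunc k i (x : J k.+1) :
  vanish k (jshift k i x - jshift k i (jproj k x)).
Proof.
move=> a I Ik.
have ucB (y z : J k) : ucoord (y - z) a I = ucoord y a I - ucoord z a I.
  by rewrite addrC -scaleN1r ucoord_linear scaleN1r addrC.
by rewrite ucB !ucoord_jshift ucoord_jproj weight_add1 Ik (ltnW Ik) subrr.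
Qed.

End JetSpaces.

(** * The module of forms on a ball *)

Section BallForms.
Variables (R : realType) (m n L : nat).
Local Notation J := 'M[R]_(n, nmi m L).
Local Notation form r := (Defs.form R m n r L).
Variables (c : J) (e : R).
Local Notation O := (ball c e).
Let oO : open O := @open_ballc _ _ _ c e.
Local Notation fform r := (J -> ('I_r -> J) -> R^o).

Definition ball_form r : {pred fform r} :=
  fun w => `[< is_form O w /\ forall p v, ~ O p -> w p v = 0 >].
Arguments ball_form : clear implicits.

Lemma ball_form_submod r : submod_closed (ball_form r).
Proof.
split.
  by apply/asboolP; split=> //; exact: is_form0.
move=> k w w' /asboolP[fw w0] /asboolP[fw' w'0]; apply/asboolP; split.
  exact: is_form_lin.
move=> p v Op; have -> : (k *: w + w') p v = k * w p v + w' p v by [].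
by rewrite w0 // w'0 // mulr0 addr0.
Qed.

HB.instance Definition _ r :=
  GRing.isSubmodClosed.Build R (fform r) (ball_form r) (ball_form_submod r).

Record bform r := BForm { bval : fform r; bvalP : bval \in ball_form r }.
HB.instance Definition _ r := [isSub for @bval r].
HB.instance Definition _ r := [Choice of bform r by <:].
HB.instance Definition _ r := [SubChoice_isSubLmodule of bform r by <:].


Implicit Types (p q x y : J) (A B : J -> J).

Lemma bform_form r (w : bform r) : is_form O (bval w).
Proof. by have /asboolP[] := bvalP w. Qed.

Lemma bform_ext r (w w' : bform r) :
  (forall p v, O p -> bval w p v = bval w' p v) -> w = w'.
Proof.
move=> ww'; apply: val_inj; apply/funext => p; apply/funext => v.
have [Op|nOp] := pselect (O p); first exact: ww'.
have /asboolP[_ w0] := bvalP w; have /asboolP[_ w'0] := bvalP w'.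
by rewrite /= w0 // w'0.
Qed.

Lemma bval_lin r k (w w' : bform r) p v :
  bval (k *: w + w') p v = k * bval w p v + bval w' p v.
Proof. by []. Qed.

Lemma bvalB r (w w' : bform r) p v : bval (w - w') p v =
  bval w p v - bval w' p v.
Proof. by []. Qed.

Lemma bval0 r p v : bval (0 : bform r) p v = 0.
Proof. by []. Qed.

Lemma ball_cut_subproof r (w : form r) : is_form O w ->
  (fun p v => if `[< O p >] then w p v else 0) \in ball_form r.
Proof.
move=> fw; apply/asboolP; split; last by move=> p v Op; case: asboolP.
by apply: is_form_eq fw => // p v Op; case: asboolP.
Qed.

(** Forms are extended by 0 off the ball, so that forms equal on the ball are
    equal. *)
Definition ball_cut r (w : form r) (fw : is_form O w) : bform r :=
  BForm (ball_cut_subproof fw).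

Lemma ball_cutE r (w : form r) (fw : is_form O w) p v : O p ->
  bval (ball_cut fw) p v = w p v.
Proof. by move=> Op /=; case: asboolP. Qed.

Definition insb A (lA : linear A) r (w : bform r) : bform r :=
  ball_cut (is_form_ins oO lA (bform_form w)).
Definition lieb A (lA : linear A) r (w : bform r) : bform r :=
  ball_cut (is_form_lie oO lA (bform_form w)).
Definition extb r (w : bform r) : bform r.+1 :=
  ball_cut (is_form_extd oO (bform_form w)).
Definition homb r (w : bform r.+1) : bform r :=
  ball_cut (is_form_homotopy (bform_form w)).

Lemma insbE A lA r w : eq_form_on O (bval (@insb A lA r w)) (ins A (bval w)).
Proof. by move=> p v Op; rewrite ball_cutE. Qed.

Lemma liebE A lA r w : eq_form_on O (bval (@lieb A lA r w)) (lie A (bval w)).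
Proof. by move=> p v Op; rewrite ball_cutE. Qed.

Lemma extbE r w : eq_form_on O (bval (@extb r w)) (extd (bval w)).
Proof. by move=> p v Op; rewrite ball_cutE. Qed.

Lemma hombE r w : eq_form_on O (bval (@homb r w)) (homotopy c (bval w)).
Proof. by move=> p v Op; rewrite ball_cutE. Qed.

Lemma insb_linear A lA r : linear (@insb A lA r).
Proof.
move=> k w w'; apply: bform_ext => p v Op; rewrite bval_lin !insbE //.
by rewrite /ins mulr_sumr -big_split.
Qed.

Lemma derive_bval_lin r k (w w' : bform r) p x v : O p ->
  'D_x (fun q => bval (k *: w + w') q v) p =
  k * 'D_x (fun q => bval w q v) p + 'D_x (fun q => bval w' q v) p.
Proof.
move=> Op; have d (w1 : bform r) : derivable (fun q => bval w1 q v) p x.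
  exact: form_derivable (bform_form w1) Op.
have Z : 'D_x (fun q => k * bval w q v) p = k * 'D_x (fun q => bval w q v) p.
  by apply: deriveZ; exact: d.
by rewrite -Z -deriveD //; apply: derivableZ; exact: d.
Qed.

Lemma lieb_linear A lA r : linear (@lieb A lA r).
Proof.
move=> k w w'; apply: bform_ext => p v Op; rewrite bval_lin !liebE // /lie.
rewrite derive_bval_lin // mulrDr addrACA; congr (_ + _).
by rewrite /ins mulr_sumr -big_split.
Qed.

Lemma extb_linear r : linear (@extb r).
Proof.
move=> k w w'; apply: bform_ext => p v Op; rewrite bval_lin !extbE // /extd.
rewrite mulr_sumr -big_split; apply: eq_bigr => i _.
by rewrite derive_bval_lin // mulrDr mulrCA.
Qed.

HB.instance Definition _ A lA r :=
  GRing.isLinear.Build R (bform r) (bform r) *:%R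
  (@insb A lA r) (@insb_linear A lA r).
HB.instance Definition _ A lA r :=
  GRing.isLinear.Build R (bform r) (bform r) *:%R
  (@lieb A lA r) (@lieb_linear A lA r).
HB.instance Definition _ r := GRing.isLinear.Build R (bform r) (bform r.+1) *:%R
  (@extb r) (@extb_linear r).

Lemma homb0 r : @homb r 0 = 0.
Proof.
apply: bform_ext => p v Op; rewrite hombE // (homotopyE v (bform_form 0) Op).
rewrite -[RHS](mul0r (cone c r (fun=> 0) p)) -(@coneZ _ _ _ c e) //; last first.
  exact: smooth_on_cst.
by apply: (@eq_cone _ _ _ c e) => // q Oq; rewrite mul0r.
Qed.

Lemma extb_extb r (w : bform r) : extb (extb w) = 0.
Proof.
apply: bform_ext => p v Op; rewrite extbE // (eq_extd oO (@extbE _ _)) //.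
by rewrite (extd_extd oO v (bform_form w) Op).
Qed.

Lemma extb_lieb A (lA : linear A) r (w : bform r) :
  extb (lieb lA w) = lieb lA (extb w).
Proof.
apply: bform_ext => p v Op; rewrite extbE // (eq_extd oO (@liebE _ lA _ _)) //.
rewrite liebE // (eq_lie oO A (@extbE _ _)) //.
exact: (extd_lie oO v lA (bform_form w) Op).
Qed.

Lemma lieb_comm A B (lA : linear A) (lB : linear B) r (w : bform r) :
  (forall x, A (B x) = B (A x)) -> lieb lA (lieb lB w) = lieb lB (lieb lA w).
Proof.
move=> AB; apply: bform_ext => p v Op.
rewrite liebE // (eq_lie oO A (@liebE _ lB _ _)) //.
rewrite liebE // (eq_lie oO B (@liebE _ lA _ _)) //.
exact: (lie_comm oO v lA lB AB (bform_form w) Op).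
Qed.

Lemma extb_homb r (w : bform r.+1) : extb w = 0 -> extb (homb w) = w.
Proof.
move=> dw; apply: bform_ext => p v Op.
rewrite extbE // (eq_extd oO (@hombE _ _)) //.
apply: (poincare (bform_form w)) => // q u Oq.
by rewrite -extbE // dw.
Qed.

(** w is pulled back from the jets of order k: it is annihilated by the vectors
    tangent to the fibres, and so are its coefficients. *)
Definition jorder r k (w : bform r) :=
  (forall p v j, O p -> vanish k.+1 (v j) -> bval w p v = 0) /\
  (forall p x v, O p -> vanish k.+1 x -> 'D_x (fun q => bval w q v) p = 0).

Lemma jorder0 r k : jorder k (0 : bform r).
Proof. by split=> // p x v Op _; exact: (derive_cst (0 : R^o)). Qed.

Lemma jorder_lin r k b (w w' : bform r) : jorder k w -> jorder k w' ->
  jorder k (b *: w + w').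
Proof.
move=> [w1 w2] [w'1 w'2]; split=> [p v j|p x v] Op vj.
  by rewrite bval_lin (w1 _ _ _ Op vj) (w'1 _ _ _ Op vj) mulr0 addr0.
by rewrite derive_bval_lin // w2 // w'2 // mulr0 addr0.
Qed.

Lemma jorderD r k (w w' : bform r) : jorder k w -> jorder k w' ->
  jorder k (w + w').
Proof. by move=> fw fw'; have := jorder_lin 1 fw fw'; rewrite scale1r. Qed.

Lemma jorderZ r k b (w : bform r) : jorder k w -> jorder k (b *: w).
Proof. by move=> fw; have := jorder_lin b fw (jorder0 r k); rewrite addr0. Qed.

Lemma jorder_le r k l (w : bform r) : (k <= l)%N -> jorder k w -> jorder l w.
Proof.
move=> kl [w1 w2]; split=> [p v j|p x v] Op vx.
  by apply: (w1 _ _ j Op); apply: vanish_le vx.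
by apply: w2 => //; apply: vanish_le vx.
Qed.

Lemma vanish_upd k r (v : 'I_r -> J) i j x : vanish k (v j) ->
  (i = j -> vanish k x) -> vanish k (upd v i x j).
Proof. by move=> vj vx; rewrite updE; case: eqP => // ji; apply: vx. Qed.

Lemma jorder_ins k r (w : bform r) A (lA : linear A) l :
  (forall x, vanish l.+1 x -> vanish k.+1 (A x)) -> (k <= l)%N ->
  jorder k w -> jorder l (insb lA w).
Proof.
move=> vA kl [w1 w2]; split=> [p v j|p x v] Op vx.
  rewrite insbE // /ins big1 // => i _.
  apply: (w1 _ _ j Op); apply: vanish_upd => [|ij]; first exact: vanish_le vx.
  by apply: vA; rewrite ij.
rewrite (open_eq_derive x oO (g := fun q => ins A (bval w) q v)) //; last first.
  by move=> q Oq; rewrite insbE.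
rewrite (derive_ins oO A x v (bform_form w) Op) big1 // => j _.
by apply: w2 => //; apply: vanish_le vx.
Qed.

Lemma jorder_lie k r (w : bform r) A (lA : linear A) :
  (forall x, vanish k.+2 x -> vanish k.+1 (A x)) ->
  jorder k w -> jorder k.+1 (lieb lA w).
Proof.
move=> vA jw; have [i1 i2] := jorder_ins lA vA (leqnSn k) jw.
have [w1 w2] := jw; split=> [p v j|p x v] Op vx.
  rewrite liebE // /lie -insbE // (i1 _ _ _ Op vx) addr0.
  apply: (derive_on0 oO) Op => q Oq; apply: (w1 _ _ j Oq); exact: vanish_le vx.
rewrite (open_eq_derive x oO (g := fun q => lie A (bval w) q v)) //; last first.
  by move=> q Oq; rewrite liebE.
rewrite /lie deriveD; first last.
- exact: (form_derivable (is_form_ins oO lA (bform_form w)) Op).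
- apply: (smooth_on_derivable _ Op); apply: smooth_on_dir_derive => //.
  exact: form_smooth (bform_form w) _.
rewrite (derive_dir_derive oO x lA (form_smooth (bform_form w) v) Op).
rewrite w2 //; last exact: vA.
rewrite (schwarz x (A p) oO Op (form_smooth (bform_form w) v)).
rewrite (derive_on0 oO) // ?add0r; last first.
  by move=> q Oq; apply: w2 => //; exact: vanish_le vx.
rewrite -(i2 p x v Op vx); apply: open_eq_derive Op => // q Oq.
by rewrite insbE.
Qed.

Lemma jorder_extb k r (w : bform r) : jorder k w -> jorder k (extb w).
Proof.
move=> [w1 w2]; have ws v : smooth_on O (fun q => bval w q v) :=
  form_smooth (bform_form w) v.
split=> [p v j|p x v] Op vx.
  rewrite extbE // /extd big1 // => i _; case: (unliftP i j) => [j'|] jE.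
    rewrite (derive_on0 oO) ?mulr0 // => q Oq.
    by apply: (w1 _ _ j' Oq); rewrite -jE.
  by rewrite w2 ?mulr0 // -jE.
rewrite (open_eq_derive x oO (g := fun q => extd (bval w) q v)) //; last first.
  by move=> q Oq; rewrite extbE.
have -> : (fun q => extd (bval w) q v) = \sum_(i < r.+1) ((-1) ^+ i : R) *:
    'D_(v i) (fun q => bval w q (fun j => v (lift i j))).
  by apply/funext => q; rewrite fct_sumE.
have di (i : 'I_r.+1) : derivable ('D_(v i) (fun q => bval w q (fun j => v (lift
  i j)))) p x.
  by apply: smooth_on_derivable Op; exact: smooth_on_derive.
rewrite derive_sum; last by move=> i; exact: derivableZ.
rewrite big1 // => i _; rewrite deriveZ // (schwarz x (v i) oO Op (ws _)).
by rewrite (derive_on0 oO) ?scaler0 // => q Oq; exact: w2.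
Qed.

Lemma jorder_homb k r (w : bform r.+1) : jorder k w -> jorder k (homb w).
Proof.
move=> [w1 w2]; have fw := bform_form w.
have cone_eq0 l f p : O p -> (forall q, O q -> f q = 0) -> cone c l f p = 0.
  move=> Op f0; rewrite -[RHS](mul0r (cone c l (fun=> 0) p)) -(@coneZ _ _ _ c e)
    //.
    by apply: (@eq_cone _ _ _ c e) => // q Oq; rewrite mul0r f0.
  exact: smooth_on_cst.
split=> [p v j|p x v] Op vx.
  rewrite hombE // (homotopyE v fw Op) cone_eq0 // => q Oq.
  by apply: (w1 _ _ (lift ord0 j) Oq); rewrite fconsS.
rewrite (open_eq_derive x oO (g := fun q => homotopy c (bval w) q v)) //;
  last first.
  by move=> q Oq; rewrite hombE.
rewrite (derive_homotopy x v fw Op) !cone_eq0 ?addr0 // => q Oq.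
  exact: w2.
by apply: (w1 _ _ ord0 Oq); rewrite fcons0.
Qed.

End BallForms.

(** * The complex of the total exterior derivative *)

Section TotalDerivatives.
Variables (R : realType) (m n L : nat).
Local Notation J := 'M[R]_(n, nmi m L).
Variables (c : J) (e : R).
Local Notation O := (ball c e).
Local Notation bform := (@bform R m n L c e).
Let oO : open O := @open_ballc _ _ _ c e.
Implicit Types S T : {set 'I_m}.

(** The total derivative truncated to jets of order L, and the vertical
    endomorphism in the same direction. *)
Definition totb r (i : 'I_m) : {linear bform r -> bform r} :=
  lieb (@jshift_linear R m n L L i) (r := r).
Definition verb r (i : 'I_m) : {linear bform r -> bform r} :=
  insb (@vlower_linear R m n L i) (r := r).

Lemma jorder_totb r k i (w : bform r) : jorder k w -> jorder k.+1 (totb r i w).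
Proof. by apply: jorder_lie => x; exact: vanish_jshift. Qed.

Lemma jorder_verb r k i (w : bform r) : jorder k w -> jorder k (verb r i w).
Proof.
apply: jorder_ins => // x vx; apply: vanish_le (vanish_vlower i vx);
  exact: leqnSn.
Qed.

Lemma totb_comm r i j (w : bform r) :
  totb r i (totb r j w) = totb r j (totb r i w).
Proof. by apply: lieb_comm => x; exact: jshift_comm. Qed.

(** By ins_lie, the commutator is the insertion of the commutator of the two
    linear maps.  That is 0, or the identity in each of the r arguments, up to
    vectors of order L, which w does not see. *)
Lemma verb_totb r k i j (w : bform r) : (k < L)%N -> jorder k w ->
  verb r i (totb r j w) = totb r j (verb r i w) + (if i == j then r%:R *: w else
    0).
Proof.
move=> kL [w1 _]; apply: bform_ext => p v Op; have fw := bform_form w.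
have -> : bval (totb r j (verb r i w) + (if i == j then r%:R *: w else 0)) p v =
  bval (totb r j (verb r i w)) p v + (if i == j then r%:R * bval w p v else 0).
  by case: eqP => // _; rewrite addr0.
rewrite insbE // (eq_ins _ (@liebE _ _ _ _ _ _ _ (@jshift_linear R m n L L j) _
  _)) //.
rewrite liebE // (eq_lie oO _ (@insbE _ _ _ _ _ _ _ (@vlower_linear R m n L i) _
  _)) //.
apply/eqP; rewrite addrC -subr_eq; apply/eqP.
rewrite (ins_lie oO v (@jshift_linear R m n L L j) (@vlower_linear R m n L i) fw
  Op).
rewrite /ins (eq_bigr (fun=> if i == j then bval w p v else 0)) => [|l _].
  by case: eqP => _; rewrite sumr_const card_ord ?mul0rn // mulr_natl.
have := jshift_vlower j i (v l); set y := jshift _ _ _ - _;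
  set z := if _ then _ else _.
move=> vyz; rewrite -[y](subrK z) (form_argD fw) // (w1 _ _ l Op) ?add0r.
  rewrite /z; case: eqP => _; first by rewrite upd_id.
  by apply: (form0 fw Op (j := l)); rewrite upd_same.
by rewrite upd_same; apply: vanish_le vyz.
Qed.

(* w vanishes on vectors whose orders of vanishing add up to at least d *)
Let total_order r (d : nat) (w : bform r) := forall (f : 'I_r ->
  nat) p v, O p ->
  (forall j, vanish (f j) (v j)) -> (d <= \sum_j f j)%N -> bval w p v = 0.

(** Each application raises the order of one of the r arguments, and w vanishes
    when an argument has order greater than k: after r * k + 1 applications
    this is so in every term. *)
Lemma verb_nilpotent r k i (w : bform r) : jorder k w ->
  iter (r * k).+1 (verb r i) w = 0.
Proof.
move=> [w1 _].
have base : total_order (r * k).+1 w.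
  move=> f p v Op vf; rewrite ltnNge => /negP nf.
  have [[j fj]|nfj] := pselect (exists j, (k < f j)%N).
    by apply: (w1 _ _ j Op); exact: vanish_le (vf j).
  case: nf; have -> : (r * k = \sum_(j < r) k)%N by rewrite sum_nat_const
    card_ord.
  by apply: leq_sum => j _; rewrite leqNgt; apply/negP => fj; apply: nfj;
    exists j.
have step d (w' : bform r) : total_order d.+1 w' -> total_order d (verb r i w').
  move=> tw f p v Op vf df; rewrite insbE // /ins big1 // => l _.
  apply: (tw (fun j => (j == l) + f j)%N) => // [j|].
    rewrite updE; case: eqP => [->|_]; last exact: vf.
    by apply: vanish_vlower; exact: vf.
  rewrite big_split /= (bigD1 l) //= eqxx big1 ?addn0 //.
  by move=> j /negPf ->.
have tw N d : total_order (N + d) w -> total_order d (iter N (verb r i) w).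
  elim: N d => //= N IH d tw; apply: step; apply: IH; by rewrite addnS.
apply: bform_ext => p v Op; apply: (tw (r * k).+1 0%N _ (fun=> 0%N)) => //.
by rewrite addn0.
Qed.

Local Notation dTb r := (koszul (totb r)).

Lemma dTb_exact r k s (w : {set 'I_m} -> bform r) : (0 < r)%N -> (s < m)%N ->
  (iter m (koszul_step r) k < L)%N ->
  (forall S, jorder k (w S)) -> (forall S, #|S| != s -> w S = 0) ->
  (forall S, dTb r w S = 0) ->
  exists y : {set 'I_m} -> bform r,
    [/\ forall S, jorder (iter m (koszul_step r) k) (y S),
        forall S, #|S|.+1 != s -> y S = 0
      & forall S, w S = dTb r y S].
Proof.
move=> r0 sm kL jw sw cw.
apply: (@koszul_exact R (bform r) m r L (totb r) (verb r) (@jorder R m n L c e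
  r)) => //.
- exact: jorder0.
- by move=> *; exact: jorderD.
- by move=> *; exact: jorderZ.
- by move=> k1 k2 x; exact: jorder_le.
- by move=> *; exact: jorder_totb.
- by move=> *; exact: jorder_verb.
- by move=> *; exact: totb_comm.
- by move=> k1 i j x; exact: verb_totb.
- by move=> *; exact: verb_nilpotent.
Qed.

Lemma extb_dTb r (w : {set 'I_m} -> bform r) S :
  extb (dTb r w S) = dTb r.+1 (fun T => extb (w T)) S.
Proof.
rewrite /koszul linear_sum; apply: eq_bigr => i _.
by rewrite linearZ /= extb_lieb.
Qed.

Lemma jorder_dTb r k (w : {set 'I_m} -> bform r) S :
  (forall S, jorder k (w S)) -> jorder k.+1 (dTb r w S).
Proof.
move=> jw; apply: big_ind => [|x y|i _]; [exact: jorder0|exact: jorderD|].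
by apply: jorderZ; exact: jorder_totb.
Qed.

End TotalDerivatives.
Local Notation dTb r := (koszul (@totb _ _ _ _ _ _ r)).

(** The diagram chase, by induction on s.  From d w = d_T z follows that d z is
    closed for d_T, so d z = d_T y by exactness of the column; the induction
    hypothesis for z and y yields x' with z - d_T x' closed, which is d x by the
    Poincare lemma.  Then d (d_T x) = d_T (d x) = d_T z = d w, because d_T d_T x'
    vanishes.  The order k' depends on neither the forms nor the ball: hence the
    whole argument can take place on one ball in the jets of one large order L. *)
Theorem closed_mod_dTb m s r k : (s <= m)%N -> exists k' : nat,
  forall (R : realType) (n L : nat) (c : 'M[R]_(n, nmi m L)) (e : R)
    (w : {set 'I_m} -> bform c e r) (z : {set 'I_m} -> bform c e r.+1),
    (k' < L)%N ->
    (forall S, jorder k (w S)) -> (forall S : {set 'I_m}, #|S| != s ->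
      w S = 0) ->
    (forall S, jorder k (z S)) -> (forall S : {set 'I_m}, #|S|.+1 != s ->
      z S = 0) ->
    (forall S, extb (w S) = dTb r.+1 z S) ->
  exists x : {set 'I_m} -> bform c e r,
    [/\ forall S, jorder k' (x S), forall S : {set 'I_m}, #|S|.+1 != s ->
      x S = 0
      & forall S, extb (w S - dTb r x S) = 0].
Proof.
elim: s r k => [|s IH] r k sm.
  exists k => R n L c e w z kL jw sw jz sz wz.
  exists (fun=> 0); split=> // [S|S]; first exact: jorder0.
  have z0 T : z T = 0 by exact: sz.
  have -> : dTb r (fun=> 0 : bform c e r) S = 0.
    by apply: big1 => i _; rewrite linear0 scaler0.
  by rewrite subr0 wz; apply: big1 => i _; rewrite z0 linear0 scaler0.
pose k1 := iter m (koszul_step r.+2) k.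
have [k' Hk'] := IH r.+1 k1 (ltnW sm).
exists (k1 + k'.+1)%N => R n L c e w z kL jw sw jz sz wz.
have k1L : (k1 < L)%N by apply: leq_ltn_trans kL; exact: leq_addr.
have k'L : (k' < L)%N by apply: leq_ltn_trans kL;
  rewrite addnS leqW // leq_addl.
have kk1 : (k <= k1)%N by exact: iter_step_ge.
have cz S : dTb r.+2 (fun T => extb (z T)) S =
  0 by rewrite -extb_dTb -wz extb_extb.
have jez S : jorder k (extb (z S)) by exact: jorder_extb.
have sez (S : {set 'I_m}) : #|S| != s -> extb (z S) = 0.
  by move=> Ss; rewrite sz // linear0.
have [y [jy sy zy]] := dTb_exact (ltn0Sn _) sm k1L jez sez cz.
have jz1 S : jorder k1 (z S) by exact: jorder_le (jz S).
have sz1 (S : {set 'I_m}) : #|S| != s -> z S = 0 by move=> Ss; exact: sz.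
have [x' [jx' sx' zx']] := Hk' R n L c e z y k'L jz1 sz1 jy sy zy.
exists (fun S => homb (z S - dTb r.+1 x' S)); split.
- move=> S; apply: (@jorder_le _ _ _ _ _ _ _ (maxn k k'.+1)).
    by rewrite geq_max leq_addl (leq_trans kk1) // leq_addr.
  apply: jorder_homb; apply: jorderD; first by apply: jorder_le (jz S);
    exact: leq_maxl.
  rewrite -scaleN1r; apply: jorderZ; apply: (jorder_le (leq_maxr _ _)).
  exact: jorder_dTb.
- move=> S Ss; rewrite sz // sub0r [dTb _ _ _]big1 ?oppr0 ?homb0 // => i iS.
  rewrite sx' ?linear0 ?scaler0 //.
  by move: Ss; rewrite (cardsD1 i) iS.
- move=> S; rewrite linearB /= extb_dTb wz -koszulB.
  have E T : z T - extb (homb (z T - dTb r.+1 x' T)) = dTb r.+1 x' T.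
    by rewrite extb_homb // opprB addrC subrK.
  rewrite /koszul; under eq_bigr do rewrite E.
  by rewrite -/(koszul _ _ _) koszul_koszul // => i j x; exact: totb_comm.
Qed.

(** * Pulling back to higher jets *)

Section Pulling.
Variables (R : realType) (m n : nat).
Local Notation J k := 'M[R]_(n, nmi m k).
Local Notation form r k := (Defs.form R m n r k).
Implicit Types (S T : {set 'I_m}).

Lemma jproj_continuous k l : continuous (@jproj R m n l k : J l -> J k).
Proof.
move=> p; apply: differentiable_continuous; apply: linear_mx_differentiable.
exact: jproj_linear.
Qed.

Lemma jproj_vanish k l (x : J l) : vanish k.+1 x -> jproj k x = 0.
Proof.
move=> vx; apply: (@vanish_eq0 _ _ _ _ k.+1) => // a I Ik.
by rewrite ucoord_jproj; case: ifP => // _; exact: vx.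
Qed.

Lemma jproj_upd k l r (v : 'I_r -> J l) j x :
  (fun i => jproj k (upd v j x i)) = upd (fun i => jproj k (v i)) j (jproj k x).
Proof. by apply/funext => i; rewrite !updE; case: ifP. Qed.

Definition pullf r k l (w : form r k) : form r l :=
  fun p v => w (jproj k p) (fun j => jproj k (v j)).

Arguments pullf {r k} l w p v.

Section Fixed.
Variables (r k l : nat) (w : form r k) (W : set (J k)).
Hypothesis fw : is_form W w.

Lemma is_form_pullf (O : set (J l)) : open O ->
  (forall q, O q -> W (jproj k q)) -> is_form O (pullf l w).
Proof.
move=> oO OW; apply: is_formI.
- move=> v; apply: smooth_on_comp_linear (form_smooth fw _) => //.
  exact: jproj_linear.
- move=> p v j b x y Op; rewrite /pullf !jproj_upd jproj_linear.
  by rewrite (form_linear fw) //; exact: OW.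
- move=> p v i j Op ij vij; apply: (form_alt fw (OW _ Op) ij).
  by rewrite vij.
Qed.

Lemma derive_pullf q x v : W (jproj k q) ->
  'D_x (fun p => pullf l w p v) q =
  'D_(jproj k x) (fun p => w p (fun j => jproj k (v j))) (jproj k q).
Proof.
move=> Wq; apply: (@derive_comp_linear _ _ _ _ _ _ _ (fun p => w p (fun j =>
  jproj k (v j)))).
  exact: jproj_linear.
exact: form_diff fw Wq.
Qed.

Lemma extd_pullf q v : W (jproj k q) ->
  extd (pullf l w) q v = extd w (jproj k q) (fun j => jproj k (v j)).
Proof. by move=> Wq; apply: eq_bigr => i _; rewrite derive_pullf. Qed.

(** The total derivative is the derivative at 0 of the pullback along
    jproj + t jshift. *)
Lemma dtotE i q (v : 'I_r -> J l) : W (jproj k q) ->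
  dtot i w q v =
  'D_(jshift k i q) (fun p => w p (fun j => jproj k (v j))) (jproj k q) +
  \sum_j w (jproj k q) (upd (fun j => jproj k (v j)) j (jshift k i (v j))).
Proof.
move=> Wq; rewrite /dtot; congr (_ + _).
rewrite /dtot_fun derive_basis; last exact: form_diff fw Wq.
by apply: eq_bigr => a _; apply: eq_bigr => j _; rewrite mxE.
Qed.

Lemma lie_pullf i q (v : 'I_r -> J l) : (k <= l)%N -> W (jproj k q) ->
  lie (@jshift R m n l l i) (pullf l w) q v = dtot i w q v.
Proof.
move=> kl Wq; rewrite dtotE // /lie derive_pullf // jproj_jshift //.
congr (_ + _); apply: eq_bigr => j _.
by rewrite /pullf jproj_upd jproj_jshift.
Qed.

End Fixed.

Lemma dtot_jproj r k l l' i (w : form r k) W (q : J l') v : (k < l)%N ->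
  is_form W w -> W (jproj k q) ->
  dtot i w (jproj l q) (fun j => jproj l (v j)) = dtot i w q v.
Proof.
move=> kl fw Wq; have kl' := ltnW kl.
rewrite !(dtotE fw) ?jproj_jproj // jshift_jproj //.
have -> : (fun j => jproj k (jproj l (v j))) = (fun j => jproj k (v j)).
  by apply/funext => j; rewrite jproj_jproj.
by congr (_ + _); apply: eq_bigr => j _; rewrite jshift_jproj.
Qed.

Section Ball.
Variables (L : nat) (c : J L) (e : R).
Local Notation B := (ball c e).
Let oB : open B := @open_ballc _ _ _ c e.

Lemma jorder_pullf r k (w : form r k) W (fw : is_form W w)
    (fp : is_form B (pullf L w)) :
  (forall q, B q -> W (jproj k q)) -> jorder k (ball_cut fp).
Proof.
move=> BW; split=> [p v j|p x v] Bp vx.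
  rewrite ball_cutE //; apply: (form0 fw (BW _ Bp) (j := j)).
  exact: jproj_vanish.
rewrite (open_eq_derive x oB (g := fun q => pullf L w q v)) //; last first.
  by move=> q Bq; rewrite ball_cutE.
by rewrite (derive_pullf fw); [rewrite (jproj_vanish vx) derive0|exact: BW].
Qed.

(** For forms of order less than L, the total derivative into the jets of order
    L + 1 is the pullback of the truncated one. *)
Lemma dtot_top r k i (x : bform c e r) (q : J L.+1) v : (k < L)%N ->
  jorder k x ->
  B (jproj L q) ->
  dtot i (bval x) q v = bval (@totb _ _ _ _ c e r i x) (jproj L q) (fun j =>
    jproj L (v j)).
Proof.
move=> kL [x1 x2] Bq; have fx := bform_form x.
have vd (y : J L.+1) : vanish k.+1 (jshift L i y - jshift L i (jproj L y)).
  exact: vanish_le kL (jshift_trunc i y).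
rewrite (dtotE fx) // liebE // /lie; congr (_ + _).
  rewrite -[jshift L i q](subrK (jshift L i (jproj L q))).
  set f := fun p => bval x p _.
  rewrite -[_ - _]scale1r derive_linear; last exact: form_diff fx Bq.
  by rewrite mul1r x2 ?add0r //; exact: vd.
apply: eq_bigr => j _; rewrite -[jshift L i (v j)](subrK (jshift L i (jproj L (v
  j)))).
rewrite (form_argD fx) // (x1 _ _ j Bq) ?add0r //.
by rewrite upd_same; exact: vd.
Qed.

Lemma bval_koszul r (x : {set 'I_m} -> bform c e r) S p v :
  bval (koszul (@totb _ _ _ _ c e r) x S) p v =
  \sum_(i in S) sgn R S i * bval (@totb _ _ _ _ c e r i (x (S :\ i)%SET)) p v.
Proof.
rewrite /koszul; elim: (index_enum _) => [|i s IH]; first by rewrite !big_nil.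
by rewrite !big_cons; case: ifP => // _; rewrite bval_lin IH.
Qed.

Lemma dT_top r k (x : {set 'I_m} -> bform c e r) S (q : J L.+1) v : (k < L)%N ->
  (forall S, jorder k (x S)) -> B (jproj L q) ->
  dT (fun T => bval (x T)) S q v =
  bval (koszul (@totb _ _ _ _ c e r) x S) (jproj L q) (fun j => jproj L (v j)).
Proof.
move=> kL jx Bq; rewrite bval_koszul.
by apply: eq_bigr => i _; rewrite (dtot_top i v kL).
Qed.

(** The derivative along every segment from the centre vanishes. *)
Lemma bform_cst (x : bform c e 0) p v : extb x = 0 -> B p ->
  bval x p v = bval x c (fun=> 0).
Proof.
move=> dx Bp.
have -> : v = (fun=> 0) by apply/funext => -[].
have Bs t : 0 <= t <= 1 -> B (c + t *: (p - c)) := fun t01 => seg_ball Bp t01.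
have [|t t01] := @MVT_line _ _ (fun q => bval x q (fun=> 0)) c (p - c).
  by move=> t t01; exact: form_diff (bform_form x) (Bs _ t01).
have -> : c + (p - c) = p by rewrite addrC subrK.
move=> /eqP; rewrite subr_eq => /eqP ->.
have := @extbE R m n L c e 0 x _ (fun=> p - c) (Bs _ t01).
rewrite dx bval0 /extd big_ord1 expr0 mul1r.
have -> : (fun j : 'I_0 => p - c) = (fun=> 0) by apply/funext => -[].
by move=> <-; rewrite add0r.
Qed.

End Ball.
End Pulling.
Arguments pullf {R m n r k} l w p v.

(** What is left of Phi is closed: it is d of its homotopy, or a constant when
    r = 0. *)
Lemma Xi_exact_of_closed (R : realType) (m n r K L : nat) (p : jspace R m n
  L.+1)
    (e : R) (Phi : vform R m n r K) (x g : {set 'I_m} ->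
      bform (jproj L p) e r) :
  0 < e ->
  (forall S : {set 'I_m}, #|S| != m.-1 -> x S = 0) ->
  (forall S : {set 'I_m}, #|S| != m -> g S = 0) ->
  (forall S, extb (g S) = 0) ->
  (forall S (q : jspace R m n L.+1) v, ball (jproj L p) e (jproj L q) ->
    pull Phi S q v = dT (fun S => bval (x S)) S q v +
      bval (g S) (jproj L q) (fun j => jproj L (v j))) ->
  Xi_exact p (pull Phi : vform R m n r L.+1).
Proof.
move=> e0 sx sg dg PhiE; set pL := jproj L p.
have near_p : \forall q \near p, ball pL e (jproj L q).
  by apply: (@jproj_continuous R m n L L.+1 p (ball pL e)); exact: nbhsx_ballx.
have Ox : Omega m.-1 (ball pL e) (fun S => bval (x S)).
  split=> [S|S q v Bq Sm]; first exact: bform_form.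
  by rewrite sx ?bval0.
case: r Phi x g sx sg dg PhiE Ox => [|r] Phi x g sx sg dg PhiE Ox.
  exists (ball pL e), (fun S => bval (x S)), (fun S => bval (g S) pL (fun=> 0)).
  split; first by split=> //; [exact: ball_open|exact: ballxx].
  split=> // [S Sm|]; first by rewrite sg ?bval0.
  apply: filterS near_p => q Bq S v.
  by rewrite PhiE // (bform_cst _ (dg S)).
exists [set q | ball pL e (jproj L q)], (pull (fun S => bval (homb (g S)))).
have oB : open [set q : jspace R m n L.+1 | ball pL e (jproj L q)].
  apply: open_comp; last exact: ball_open.
  by move=> q _; exact: jproj_continuous.
split => //.
- exact: ballxx.
- split=> [S|S q v Bq Sm].
    exact: (is_form_pullf (bform_form (homb (g S))) oB).
  by rewrite /pull sg // homb0 bval0.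
exists (ball pL e), (fun S => bval (x S)), (fun=> 0).
split; first by split=> //; [exact: ball_open|exact: ballxx].
split=> //; apply: filterS near_p => q Bq S v.
have -> : vextd (pull (fun S => bval (homb (g S))) : vform R m n r L.+1) S q v =
    bval (g S) (jproj L q) (fun j => jproj L (v j)).
  by rewrite /vextd (extd_pullf (bform_form (homb (g S))) v Bq) -(extbE _ _ Bq)
    extb_homb.
by rewrite PhiE // addrK addr0.
Qed.

(** The order l is fixed before the forms.  The hypothesis is pulled back to a
    ball around the projection of p to the jets of order l - 1, on which
    closed_mod_dTb applies; the last order makes room for the untruncated
    total exterior derivative. *)
Theorem local_exactness m r K : (0 < m)%N -> (0 < K)%N ->
  exists l : nat, (K < l)%N /\
  forall (R : realType) (n : nat) (p : jspace R m n l) (O : set (jspace R m n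
    K))
    (Phi : vform R m n r K),
    open O -> O (jproj K p) -> Omega m O Phi ->
    Xi_zero (jproj K p) (vextd Phi) -> Xi_exact p (pull Phi : vform R m n r l).
Proof.
move=> m0 K0; have [k' Hk'] := @closed_mod_dTb m m r K (leqnn m).
(* L exceeds both the order k' of the primitive and the order K of Phi *)
pose L := (k' + K).+1; have k'L : (k' < L)%N by rewrite ltnS leq_addr.
have KL : (K <= L)%N by rewrite leqW // leq_addl.
exists L.+1; split=> // R n p O Phi oO Op [fPhi sPhi].
move=> [W [z [c [[oW Wp [fz sz]] [c1 c2 zE]]]]].
pose pL := jproj L p.
have pLK : jproj K pL = jproj K p by rewrite jproj_jproj.
have c0 S : c S = 0 by exact: c2.
have [e e0 Be] : exists2 e : R, 0 < e & forall q, ball pL e q ->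
    [/\ O (jproj K q), W (jproj K.-1 q) & forall S v,
       vextd Phi S (jproj K q) v = dT z S (jproj K q) v].
  have n1 : nbhs pL (jproj K @^-1` O).
    by apply: (@jproj_continuous R m n K L pL); rewrite pLK;
      apply: open_nbhs_nbhs.
  have n2 : nbhs pL (jproj K.-1 @^-1` W).
    apply: (@jproj_continuous R m n K.-1 L pL); apply: open_nbhs_nbhs;
      split=> //.
    by move: Wp; rewrite -pLK jproj_jproj ?leq_pred.
  have n3 : nbhs pL (jproj K @^-1` [set q | forall S v, vextd Phi S q v =
    dT z S q v]).
    apply: (@jproj_continuous R m n K L pL); rewrite pLK.
    by apply: filterS zE => q zE S v; rewrite zE c0 addr0.
  have n123 : nbhs pL ((jproj K @^-1` O) `&` ((jproj K.-1 @^-1` W) `&`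
    (jproj K @^-1` [set q | forall S v, vextd Phi S q v = dT z S q v]))).
    by apply: filterI => //; exact: filterI.
  have /nbhs_ballP[e /= e0 Be] := n123.
  by exists e => // q /Be [h1 [h2 h3]].
have BO q : ball pL e q -> O (jproj K q) by case/Be.
have BW q : ball pL e q -> W (jproj K.-1 q) by case/Be.
have oB : open (ball pL e) by exact: ball_open.
have fw S : is_form (ball pL e) (pullf L (Phi S)) :=
  is_form_pullf (fPhi S) oB BO.
have fzb S : is_form (ball pL e) (pullf L (z S)) := is_form_pullf (fz S) oB BW.
pose w S := ball_cut (fw S); pose zb S := ball_cut (fzb S).
have jw S : jorder K (w S) by exact: (jorder_pullf (fPhi S)).
have jz S : jorder K (zb S).
  by apply: jorder_le (leq_pred K) _; exact: (jorder_pullf (fz S)).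
have sw (S : {set 'I_m}) : #|S| != m -> w S = 0.
  move=> Sm; apply: bform_ext => q v Bq; rewrite ball_cutE // bval0.
  by apply: sPhi => //; exact: BO.
have szb (S : {set 'I_m}) : #|S|.+1 != m -> zb S = 0.
  move=> Sm; apply: bform_ext => q v Bq; rewrite ball_cutE // bval0.
  by apply: sz; [exact: BW|apply: contra Sm => /eqP ->; rewrite prednK].
have wz S : extb (w S) = koszul (@totb R m n L pL e r.+1) zb S.
  apply: bform_ext => q v Bq; have [Oq Wq zEq] := Be q Bq.
  rewrite extbE // (eq_extd oB (ball_cutE (fw S))) //.
  rewrite (extd_pullf (fPhi S)) // -[LHS]/(vextd Phi S _ _) zEq bval_koszul.
  apply: eq_bigr => i _; congr (_ * _).
  rewrite liebE // (eq_lie oB _ (ball_cutE (fzb _))) //.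
  rewrite (lie_pullf (fz _) i v (leq_trans (leq_pred K) KL) Wq).
  rewrite (dtot_jproj i v _ (fz _) Wq) //.
  by rewrite ltn_predL.
have [x [jx sx dx]] := Hk' R n L pL e w zb k'L jw sw jz szb wz.
apply: (@Xi_exact_of_closed _ _ _ _ _ _ _ e _ x
  (fun S => w S - koszul (@totb R m n L pL e r) x S)) => //.
- move=> S Sm; apply: sx.
  by apply: contra Sm => /eqP E; rewrite -(congr1 predn E).
- move=> S Sm; rewrite sw // sub0r /koszul big1 ?oppr0 // => i iS.
  rewrite sx ?linear0 ?scaler0 //.
  by move: Sm; rewrite (cardsD1 i) iS.
- move=> S q v Bq; rewrite (dT_top _ _ k'L) // bvalB addrC subrK ball_cutE //.
  rewrite /pull /pullf jproj_jproj //; congr (Phi S _ _).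
  by apply/funext => j; rewrite jproj_jproj.
Qed.

Lemma jproj_jcoord (R : realType) (m n k l : nat) (E : manifold R n)
    (x : chart R n E) (g : 'rV[R]_m -> E) : (k <= l)%N ->
  jproj k (jcoord x l g) = jcoord x k g.
Proof.
move=> kl; pose f a I := mi_deriv I (fun t => cmap x (g t) 0 a) 0.
have cE k' : jcoord x k' g = \matrix_(a, j) f a (mi j) by [].
apply: ucoord_inj => a I; rewrite !cE ucoord_jproj !ucoord_mx.
by case: (leqP (weight I) k) => // Ik; rewrite (leq_trans Ik kl).
Qed.

Theorem mainTheorem9 (R : realType) (m n : nat) (E : manifold R n) (k : int)
  (hm : (0 < m)%N) (hk : - m%:Z < k) :
  let K := absz (k + m%:Z) in
  forall (r : nat) (hr : (r <= jet_dim m n K.-1)%N)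
    (U : set (set ('rV[R]_m -> E))) (hU : jet_open K U)
    (Phi : chart R n E -> vform R m n r K) (hPhi : Omega_on m U Phi),
    (forall g : 'rV[R]_m -> E, immersion0 g -> U (jet K g) ->
     forall x : chart R n E, atlas x -> cdom x (g 0) ->
       Xi_zero (jcoord x K g) (vextd (Phi x))) ->
  exists l : nat, (K < l)%N /\
    forall g : 'rV[R]_m -> E, immersion0 g -> U (jet K g) ->
    forall x : chart R n E, atlas x -> cdom x (g 0) ->
      Xi_exact (jcoord x l g) (pull (Phi x)).
Proof.
move=> K r _ U [_ oU] Phi [fPhi _] closed.
have K0 : (0 < K)%N by rewrite /K; lia.
have [l [Kl Hl]] := local_exactness r hm K0.
exists l; split=> // g ig Ug x ax gx.
have E0 := jproj_jcoord x g (ltnW Kl).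
apply: (Hl _ _ _ _ _ (oU x ax)); rewrite ?E0; [|exact: fPhi|exact: closed].
by exists g.
Qed.
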